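(* Let $n \ge 1$, $\alpha = (\alpha_1,\dots,\alpha_n), \beta = (\beta_1,\dots,\beta_n) \in \mathbb{C}^n$, and let $h_\alpha$, $h_\beta$ be holizations of $A(\alpha)$ and $A(\beta)$ respectively, with $V(\alpha) = h_\alpha(\mathbb{D})$, $V(\beta) = h_\beta(\mathbb{D})$. Then there is a biholomorphic homeomorphism from $V(\alpha)$ onto $V(\beta)$ if and only if there is a constant $\tau \in \mathbb{C}$ with $|\tau| = 1$ such that $\beta_j = \tau^{2j-1}\alpha_j$ for all $1 \le j \le n$.
   Context: $\mathbb{D}$ is the open unit disk, $O(\mathbb{D})$ the holomorphic functions on it. For $\alpha \in \mathbb{C}^n$, let $\pi_\alpha(z) = z^2 + \alpha_1 z^3 + \alpha_2 z^5 + \dots + \alpha_n z^{2n+1}$ and let $A(\alpha) = \{ p\circ\pi_\alpha + z^{2n+2} g : p \text{ a polynomial of degree} \le n,\ g \in O(\mathbb{D})\}$, the simple cusp subalgebra of $O(\mathbb{D})$ of codimension $n+1$ with primitive $\pi_\alpha$. A holomap is a proper holomorphic map $h : \mathbb{D} \to \Omega$ into an open set $\Omega \subsetneq \mathbb{C}^N$ which is one-to-one and non-singular except on a finite set. For $V = h(\mathbb{D})$, $O(V)$ is the algebra of functions on $V$ which near each point $P \in V$ agree with the restriction of a function holomorphic in a neighborhood of $P$ in $\mathbb{C}^N$, and $A_h = \{F\circ h : F \in O(V)\}$. A holomap $h$ holizes (is a holization of) a subalgebra $A \subseteq O(\mathbb{D})$ if $A = A_h$. A biholomorphic homeomorphism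 $\phi : V_1 \to V_2$ is a homeomorphism such that the coordinates of $\phi$ lie in $O(V_1)$ and those of $\phi^{-1}$ lie in $O(V_2)$. *)

(* Defs.v *)
From Stdlib Require Import Reals.
Open Scope R_scope.

Definition Cx : Type := (R * R)%type.
Definition C0 : Cx := (0, 0).
Definition C1 : Cx := (1, 0).
Definition Cadd (z w : Cx) : Cx := (fst z + fst w, snd z + snd w).
Definition Copp (z : Cx) : Cx := (- fst z, - snd z).
Definition Csub (z w : Cx) : Cx := Cadd z (Copp w).
Definition Cmul (z w : Cx) : Cx :=
  (fst z * fst w - snd z * snd w, fst z * snd w + snd z * fst w).
Fixpoint Cpow (z : Cx) (k : nat) : Cx :=
  match k with O => C1 | S k' => Cmul z (Cpow z k') end.
Definition Cnorm (z : Cx) : R := sqrt (fst z * fst z + snd z * snd z).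

Definition Disk (z : Cx) : Prop := Cnorm z < 1.

Fixpoint Csum (m : nat) (f : nat -> Cx) : Cx :=
  match m with O => C0 | S m' => Cadd (Csum m' f) (f m') end.

(* A point of Cx^N is a map nat -> Cx whose coordinates of index >= N vanish. *)
Definition pt := nat -> Cx.
Definition inCN (N : nat) (P : pt) : Prop := forall i, (N <= i)%nat -> P i = C0.
Fixpoint normN (N : nat) (P : pt) : R :=
  match N with O => 0 | S N' => normN N' P + Cnorm (P N') end.
Definition ptsub (P Q : pt) : pt := fun i => Csub (P i) (Q i).

Definition is_cderiv (f : Cx -> Cx) (z L : Cx) : Prop :=
  forall eps, 0 < eps -> exists delta, 0 < delta /\
    forall w, Cnorm (Csub w z) < delta ->
      Cnorm (Csub (Csub (f w) (f z)) (Cmul L (Csub w z))) <= eps * Cnorm (Csub w z).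

Definition holo_disk (f : Cx -> Cx) : Prop :=
  forall z, Disk z -> exists L, is_cderiv f z L.

Definition is_cderivN (N : nat) (F : pt -> Cx) (P : pt) (L : nat -> Cx) : Prop :=
  forall eps, 0 < eps -> exists delta, 0 < delta /\
    forall Q, inCN N Q -> normN N (ptsub Q P) < delta ->
      Cnorm (Csub (Csub (F Q) (F P)) (Csum N (fun i => Cmul (L i) (Csub (Q i) (P i)))))
        <= eps * normN N (ptsub Q P).

Definition holo_ball (N : nat) (F : pt -> Cx) (P : pt) (r : R) : Prop :=
  forall Q, inCN N Q -> normN N (ptsub Q P) < r -> exists L, is_cderivN N F Q L.

Definition openN (N : nat) (U : pt -> Prop) : Prop :=
  forall P, U P -> exists r, 0 < r /\
    forall Q, inCN N Q -> normN N (ptsub Q P) < r -> U Q.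

Definition compactN (N : nat) (K : pt -> Prop) : Prop :=
  (forall P, K P -> inCN N P) /\
  (exists M, forall P, K P -> normN N P <= M) /\
  (forall P, inCN N P ->
     (forall eps, 0 < eps -> exists Q, K Q /\ normN N (ptsub Q P) < eps) -> K P).

Definition compactC (K : Cx -> Prop) : Prop :=
  (exists M, forall z, K z -> Cnorm z <= M) /\
  (forall z, (forall eps, 0 < eps -> exists w, K w /\ Cnorm (Csub w z) < eps) -> K z).

Definition holomap (N : nat) (Omega : pt -> Prop) (h : Cx -> pt) : Prop :=
  (forall P, Omega P -> inCN N P) /\ openN N Omega /\
  (exists P, inCN N P /\ ~ Omega P) /\
  (forall z, Disk z -> Omega (h z)) /\
  (forall i, (i < N)%nat -> holo_disk (fun z => h z i)) /\
  (forall K, (forall P, K P -> Omega P) -> compactN N K ->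
     compactC (fun z => Disk z /\ K (h z))) /\
  (exists E : list Cx, (forall e, List.In e E -> Disk e) /\
     (forall z w, Disk z -> Disk w -> ~ List.In z E -> ~ List.In w E ->
        h z = h w -> z = w) /\
     (forall z, Disk z -> ~ List.In z E ->
        exists i L, (i < N)%nat /\ is_cderiv (fun u => h u i) z L /\ L <> C0)).

Definition image_disk (h : Cx -> pt) (P : pt) : Prop := exists z, Disk z /\ h z = P.

Definition OV (N : nat) (V : pt -> Prop) (F : pt -> Cx) : Prop :=
  forall P, V P -> exists r G, 0 < r /\ holo_ball N G P r /\
    forall Q, V Q -> normN N (ptsub Q P) < r -> F Q = G Q.

Definition A_h (N : nat) (h : Cx -> pt) (f : Cx -> Cx) : Prop :=
  exists F, OV N (image_disk h) F /\ forall z, Disk z -> f z = F (h z).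

(* h holizes the subalgebra A of O(D) (membership compared on D) *)
Definition holizes (N : nat) (h : Cx -> pt) (A : (Cx -> Cx) -> Prop) : Prop :=
  forall f, A f <-> A_h N h f.

(* alpha : nat -> Cx, with alpha j meaning alpha_j for 1 <= j <= n *)
Definition pi_alpha (n : nat) (alpha : nat -> Cx) (z : Cx) : Cx :=
  Cadd (Cpow z 2) (Csum n (fun k => Cmul (alpha (S k)) (Cpow z (2 * S k + 1)))).

Definition A_cusp (n : nat) (alpha : nat -> Cx) (f : Cx -> Cx) : Prop :=
  exists (c : nat -> Cx) (g : Cx -> Cx), holo_disk g /\
    forall z, Disk z ->
      f z = Cadd (Csum (S n) (fun k => Cmul (c k) (Cpow (pi_alpha n alpha z) k)))
                 (Cmul (Cpow z (2 * n + 2)) (g z)).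

Definition contV (N1 N2 : nat) (V : pt -> Prop) (phi : pt -> pt) : Prop :=
  forall P, V P -> forall eps, 0 < eps -> exists delta, 0 < delta /\
    forall Q, V Q -> normN N1 (ptsub Q P) < delta ->
      normN N2 (ptsub (phi Q) (phi P)) < eps.

Definition biholo_homeo (N1 N2 : nat) (V1 V2 : pt -> Prop) (phi : pt -> pt) : Prop :=
  exists psi : pt -> pt,
    (forall P, V1 P -> V2 (phi P)) /\ (forall Q, V2 Q -> V1 (psi Q)) /\
    (forall P, V1 P -> psi (phi P) = P) /\ (forall Q, V2 Q -> phi (psi Q) = Q) /\
    contV N1 N2 V1 phi /\ contV N2 N1 V2 psi /\
    (forall i, (i < N2)%nat -> OV N1 V1 (fun P => phi P i)) /\
    (forall i, (i < N1)%nat -> OV N2 V2 (fun Q => psi Q i)).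

(* Main.v *)
From Stdlib Require Import NArith Reals Lra Lia Classical ClassicalEpsilon FunctionalExtensionality.
From Coquelicot Require Import Rcomplements Hierarchy Continuity Derive RInt.
Require Import Defs.
Open Scope R_scope.

(** A biholomorphism between the images is the same thing as a bijection [theta] of the disk whose
    pullback carries A(beta) onto A(alpha). Since [z^(2n+2)] and [z^(2n+3)] lie in both algebras,
    [theta] is a quotient of holomorphic functions, hence continuous, and holomorphic off its zero.

    If [theta 0 = b <> 0], then, functions of A(alpha) having no linear term at [0], the inverse of
    [theta] would behave near [b] like a continuous branch of [sqrt (w - b)]. So [theta 0 = 0];
    comparing orders of vanishing, [theta] is holomorphic at [0] too, and the Schwarz lemma applied
    to [theta] and its inverse gives [theta z = tau z] with [|tau| = 1]. Finally
    [pi_beta (tau z) - tau^2 pi_alpha z] is an odd polynomial of degree at most [2n+1] lying in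
    A(alpha); the powers of [pi_alpha] having even order, it must vanish.

    The maximum principle behind the Schwarz lemma comes from Goursat's bisection argument, carried
    out in the coordinate [c + exp (s + i t)], which yields the mean value property on circles. *)

(* All that is known about [theta] is that pulling back along it preserves the algebras, so each of
   its properties must be extracted from [theta ^ (2 * n + 2)], [theta ^ (2 * n + 3)] or
   [pi_alpha n beta] of [theta], and a quotient of two of these says nothing at the zero of [theta].
   The argument uses neither power series nor removable singularities, and this gives three places
   their form. Order of vanishing is a growth condition, which makes sense for functions not known
   to be holomorphic. Division by [z ^ (2 * n + 2)] is read off from the definition of A(alpha):
   once the polynomial part is seen to vanish, the holomorphic cofactor is the [g] already present.
   The maximum principle admits isolated points of mere continuity, so that it covers [f z / z] at
   0. The exponent in the theorem comes from comparing two scalings: a rotation by tau multiplies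
   [z ^ (2 * j + 1)] by [tau ^ (2 * j + 1)], but the leading term of the primitive by [tau ^ 2],
   which leaves [2 * j - 1]. *)
Declare Scope cx_scope.
Delimit Scope cx_scope with cx.
Infix "+" := Cadd : cx_scope.
Infix "-" := Csub : cx_scope.
Infix "*" := Cmul : cx_scope.
Notation "- z" := (Copp z) : cx_scope.
Infix "^" := Cpow : cx_scope.

(** * The complex field *)

Definition Cinv (z : Cx) : Cx :=
  (fst z / (fst z * fst z + snd z * snd z), - snd z / (fst z * fst z + snd z * snd z)).
Definition Cdiv (z w : Cx) : Cx := Cmul z (Cinv w).
Infix "/" := Cdiv : cx_scope.

Lemma Cx_ext (z w : Cx) : fst z = fst w -> snd z = snd w -> z = w.
Proof. destruct z, w; simpl; intros; subst; reflexivity. Qed.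

Lemma sqr_sum_pos (z : Cx) : z <> C0 -> 0 < fst z * fst z + snd z * snd z.
Proof.
  intros Hz. destruct z as [x y]; simpl in *.
  destruct (Req_dec x 0) as [->|Hx].
  - destruct (Req_dec y 0) as [->|Hy]; [now contradict Hz|nra].
  - nra.
Qed.

Lemma Cx_field_theory :
  field_theory C0 C1 Cadd Cmul Csub Copp Cdiv Cinv (@eq Cx).
Proof.
  constructor; [constructor| | |]; intros; try (apply Cx_ext; simpl; ring).
  - intros H; apply (f_equal fst) in H; simpl in H; lra.
  - pose proof (sqr_sum_pos p H). apply Cx_ext; simpl; field; lra.
Qed.

(** Lets [ring] and [field] compute with literal exponents. A symbolic exponent such as [2 * n + 2]
    remains an atom and has to be split by [Cpow_add] beforehand. *)
Lemma Cpow_power_theory :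
  power_theory C1 Cmul (@eq Cx) N.to_nat Cpow.
Proof.
  constructor. intros r k. destruct k as [|p]; [reflexivity|]. simpl.
  induction p as [|p IH] using Pos.peano_ind; [simpl; apply Cx_ext; simpl; ring|].
  rewrite Pnat.Pos2Nat.inj_succ. simpl Cpow. rewrite IH.
  rewrite pow_pos_succ; try reflexivity.
  - repeat constructor; congruence.
  - intros x y ? a b ?; congruence.
  - intros; apply Cx_ext; simpl; ring.
Qed.

Ltac nat_cst t :=
  match isnatcst t with true => constr:(N.of_nat t) | _ => constr:(InitialRing.NotConstant) end.

Add Field Cx_field : Cx_field_theory (power_tac Cpow_power_theory [nat_cst]).

Lemma C1_neq_C0 : C1 <> C0.
Proof. intros H; apply (f_equal fst) in H; simpl in H; lra. Qed.

Lemma Cmul_eq0 z w : (z * w)%cx = C0 -> z = C0 \/ w = C0.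
Proof.
  intros H. destruct (classic (z = C0)) as [|Hz]; [now left|right].
  replace w with ((z * w) / z)%cx by (field; exact Hz). rewrite H. field; exact Hz.
Qed.

Lemma Cmul_neq0 z w : z <> C0 -> w <> C0 -> (z * w)%cx <> C0.
Proof. intros Hz Hw H; apply Cmul_eq0 in H; tauto. Qed.

Lemma Cinv_neq0 z : z <> C0 -> Cinv z <> C0.
Proof.
  intros Hz H. apply C1_neq_C0. replace C1 with (z * Cinv z)%cx by (field; exact Hz).
  rewrite H; ring.
Qed.

Lemma Cpow_neq0 z k : z <> C0 -> (z ^ k)%cx <> C0.
Proof. intros Hz; induction k; simpl; [apply C1_neq_C0|now apply Cmul_neq0]. Qed.

Lemma Cpow_eq0 z k : (z ^ k)%cx = C0 -> z = C0.
Proof. intros H; apply NNPP; intros Hz; now apply (Cpow_neq0 z k). Qed.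

Lemma Cpow_C0 k : (C0 ^ S k)%cx = C0.
Proof. simpl; ring. Qed.

Lemma Cpow_add z j k : (z ^ (j + k))%cx = (z ^ j * z ^ k)%cx.
Proof. induction j; simpl; [ring|rewrite IHj; ring]. Qed.

Lemma Cpow_mull z w k : ((z * w) ^ k)%cx = (z ^ k * w ^ k)%cx.
Proof. induction k; simpl; [ring|rewrite IHk; ring]. Qed.

Lemma Csub_eq0 z w : (z - w)%cx = C0 -> z = w.
Proof. intros H. replace z with ((z - w) + w)%cx by ring. rewrite H; ring. Qed.

(** * The modulus *)

Lemma Cnorm_ge0 z : 0 <= Cnorm z.
Proof. apply sqrt_pos. Qed.

Lemma Cnorm_sqr z : Cnorm z * Cnorm z = fst z * fst z + snd z * snd z.
Proof. apply sqrt_sqrt; nra. Qed.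

Lemma Cnorm_unique z r : 0 <= r -> r * r = fst z * fst z + snd z * snd z -> Cnorm z = r.
Proof. intros Hr H. unfold Cnorm. rewrite <- H. now apply sqrt_square. Qed.

Lemma Cnorm_C0 : Cnorm C0 = 0.
Proof. apply Cnorm_unique; simpl; lra. Qed.

Lemma Cnorm_C1 : Cnorm C1 = 1.
Proof. apply Cnorm_unique; simpl; lra. Qed.

Lemma Cnorm_eq0 z : Cnorm z = 0 -> z = C0.
Proof.
  intros H. apply NNPP; intros Hz. pose proof (sqr_sum_pos z Hz).
  rewrite <- Cnorm_sqr, H in H0. lra.
Qed.

Lemma Cnorm_pos z : z <> C0 -> 0 < Cnorm z.
Proof.
  intros Hz. destruct (Cnorm_ge0 z) as [|H]; [assumption|].
  exfalso; apply Hz, Cnorm_eq0; auto.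
Qed.

Lemma Cnorm_pos_neq0 z : 0 < Cnorm z -> z <> C0.
Proof. intros H ->. rewrite Cnorm_C0 in H; lra. Qed.

Lemma Cnorm_mul z w : Cnorm (z * w)%cx = Cnorm z * Cnorm w.
Proof.
  pose proof (Cnorm_ge0 z); pose proof (Cnorm_ge0 w).
  apply Cnorm_unique; [nra|].
  replace (Cnorm z * Cnorm w * (Cnorm z * Cnorm w))
    with ((Cnorm z * Cnorm z) * (Cnorm w * Cnorm w)) by ring.
  rewrite !Cnorm_sqr; simpl; ring.
Qed.

Lemma Cnorm_opp z : Cnorm (- z)%cx = Cnorm z.
Proof. apply Cnorm_unique; [apply Cnorm_ge0|rewrite Cnorm_sqr; simpl; ring]. Qed.

Lemma Cnorm_sub_sym z w : Cnorm (z - w)%cx = Cnorm (w - z)%cx.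
Proof. rewrite <- Cnorm_opp. f_equal. ring. Qed.

Lemma Cnorm_fst z : Rabs (fst z) <= Cnorm z.
Proof.
  pose proof (Cnorm_ge0 z). apply Rsqr_incr_0_var; [|assumption].
  rewrite <- Rsqr_abs. unfold Rsqr. rewrite Cnorm_sqr. nra.
Qed.

Lemma Cnorm_snd z : Rabs (snd z) <= Cnorm z.
Proof.
  pose proof (Cnorm_ge0 z). apply Rsqr_incr_0_var; [|assumption].
  rewrite <- Rsqr_abs. unfold Rsqr. rewrite Cnorm_sqr. nra.
Qed.

Lemma Cnorm_le_sum z : Cnorm z <= Rabs (fst z) + Rabs (snd z).
Proof.
  pose proof (Rabs_pos (fst z)); pose proof (Rabs_pos (snd z)).
  apply Rsqr_incr_0_var; [|lra]. unfold Rsqr at 1. rewrite Cnorm_sqr.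
  pose proof (Rsqr_abs (fst z)) as H1; pose proof (Rsqr_abs (snd z)) as H2.
  unfold Rsqr in *. nra.
Qed.

Lemma Cnorm_triang z w : Cnorm (z + w)%cx <= Cnorm z + Cnorm w.
Proof.
  pose proof (Cnorm_ge0 z); pose proof (Cnorm_ge0 w).
  apply Rsqr_incr_0_var; [|lra]. unfold Rsqr at 1. rewrite Cnorm_sqr. unfold Rsqr.
  replace ((Cnorm z + Cnorm w) * (Cnorm z + Cnorm w))
    with (Cnorm z * Cnorm z + Cnorm w * Cnorm w + 2 * (Cnorm z * Cnorm w)) by ring.
  rewrite !Cnorm_sqr. simpl.
  enough (fst z * fst w + snd z * snd w <= Cnorm z * Cnorm w) by lra.
  apply Rle_trans with (1 := Rle_abs _). apply Rsqr_incr_0_var; [|nra].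
  rewrite <- Rsqr_abs. unfold Rsqr.
  replace (Cnorm z * Cnorm w * (Cnorm z * Cnorm w))
    with ((Cnorm z * Cnorm z) * (Cnorm w * Cnorm w)) by ring.
  rewrite !Cnorm_sqr.
  pose proof (Rle_0_sqr (fst z * snd w - snd z * fst w)). unfold Rsqr in *. nra.
Qed.

Lemma Cnorm_sub_le z w : Cnorm (z - w)%cx <= Cnorm z + Cnorm w.
Proof. unfold Csub. rewrite <- (Cnorm_opp w). apply Cnorm_triang. Qed.

Lemma Cnorm_sub_ge z w : Cnorm z - Cnorm w <= Cnorm (z - w)%cx.
Proof.
  pose proof (Cnorm_triang (z - w)%cx w). replace ((z - w) + w)%cx with z in H by ring. lra.
Qed.

Lemma Cnorm_pow z k : Cnorm (z ^ k)%cx = Cnorm z ^ k.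
Proof. induction k; simpl; [apply Cnorm_C1|now rewrite Cnorm_mul, IHk]. Qed.

Lemma Cnorm_inv z : z <> C0 -> Cnorm (Cinv z) = / Cnorm z.
Proof.
  intros Hz. pose proof (Cnorm_pos z Hz).
  apply Rmult_eq_reg_l with (Cnorm z); [|lra].
  rewrite <- Cnorm_mul, Rinv_r by lra. rewrite <- Cnorm_C1. f_equal. field; exact Hz.
Qed.

Lemma Cnorm_div z w : w <> C0 -> Cnorm (z / w)%cx = Cnorm z / Cnorm w.
Proof. intros Hw. unfold Cdiv. now rewrite Cnorm_mul, Cnorm_inv. Qed.

Lemma Csub_diag z : (z - z)%cx = C0.
Proof. ring. Qed.

Lemma Cnorm_sub_diag z : Cnorm (z - z)%cx = 0.
Proof. now rewrite Csub_diag, Cnorm_C0. Qed.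

Definition Conj (z : Cx) : Cx := (fst z, - snd z).

Lemma Cnorm_conj z : Cnorm (Conj z) = Cnorm z.
Proof. apply Cnorm_unique; [apply Cnorm_ge0|rewrite Cnorm_sqr; simpl; ring]. Qed.

Lemma Cmul_conj_unit z : Cnorm z = 1 -> (z * Conj z)%cx = C1.
Proof.
  intros H. pose proof (Cnorm_sqr z) as S. rewrite H in S. apply Cx_ext; simpl; lra.
Qed.

Lemma Disk_C0 : Disk C0.
Proof. unfold Disk; rewrite Cnorm_C0; lra. Qed.

Lemma Disk_open z : Disk z ->
  exists r, 0 < r /\ forall w, Cnorm (w - z)%cx < r -> Disk w.
Proof.
  unfold Disk; intros H. exists (1 - Cnorm z). split; [lra|].
  intros w Hw. pose proof (Cnorm_sub_ge w z). lra.
Qed.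

(** * Continuity and complex differentiability *)

Definition cont_at (f : Cx -> Cx) (z : Cx) : Prop :=
  forall eps, 0 < eps -> exists delta, 0 < delta /\
    forall w, Cnorm (w - z)%cx < delta -> Cnorm (f w - f z)%cx < eps.

Lemma cont_const a z : cont_at (fun _ => a) z.
Proof. intros e He; exists 1; split; [lra|]; intros; rewrite Cnorm_sub_diag; lra. Qed.

Lemma cont_id z : cont_at (fun w => w) z.
Proof. intros e He; exists e; auto. Qed.

Lemma cont_add f g z : cont_at f z -> cont_at g z -> cont_at (fun w => f w + g w)%cx z.
Proof.
  intros Hf Hg e He.
  destruct (Hf (e / 2)) as [d1 [P1 H1]]; [lra|].
  destruct (Hg (e / 2)) as [d2 [P2 H2]]; [lra|].
  exists (Rmin d1 d2); split; [now apply Rmin_glb_lt|]. intros w Hw.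
  specialize (H1 w (Rlt_le_trans _ _ _ Hw (Rmin_l _ _))).
  specialize (H2 w (Rlt_le_trans _ _ _ Hw (Rmin_r _ _))).
  replace (f w + g w - (f z + g z))%cx with ((f w - f z) + (g w - g z))%cx by ring.
  pose proof (Cnorm_triang (f w - f z)%cx (g w - g z)%cx). lra.
Qed.

Lemma cont_bounded f z : cont_at f z ->
  exists delta, 0 < delta /\ forall w, Cnorm (w - z)%cx < delta -> Cnorm (f w) < Cnorm (f z) + 1.
Proof.
  intros Hf. destruct (Hf 1) as [d [P H]]; [lra|]. exists d; split; [assumption|].
  intros w Hw. specialize (H w Hw). pose proof (Cnorm_sub_ge (f w) (f z)). lra.
Qed.

Lemma cont_mul f g z : cont_at f z -> cont_at g z -> cont_at (fun w => f w * g w)%cx z.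
Proof.
  intros Hf Hg e He.
  pose proof (Cnorm_ge0 (f z)) as N1; pose proof (Cnorm_ge0 (g z)) as N2.
  set (K := Cnorm (f z) + Cnorm (g z) + 1).
  assert (HK : 0 < K) by (unfold K; lra).
  assert (He2 : 0 < e / 2 / K) by (apply Rdiv_lt_0_compat; lra).
  destruct (Hf _ He2) as [d1 [P1 H1]].
  destruct (Hg _ He2) as [d2 [P2 H2]].
  destruct (cont_bounded f z Hf) as [d3 [P3 H3]].
  exists (Rmin d1 (Rmin d2 d3)); split; [repeat apply Rmin_glb_lt; auto|]. intros w Hw.
  pose proof (Rmin_l d1 (Rmin d2 d3)); pose proof (Rmin_r d1 (Rmin d2 d3)).
  pose proof (Rmin_l d2 d3); pose proof (Rmin_r d2 d3).
  assert (W1 := H1 w ltac:(lra)). assert (W2 := H2 w ltac:(lra)). assert (W3 := H3 w ltac:(lra)).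
  replace (f w * g w - f z * g z)%cx with (f w * (g w - g z) + g z * (f w - f z))%cx by ring.
  eapply Rle_lt_trans; [apply Cnorm_triang|]. rewrite !Cnorm_mul.
  set (q := e / 2 / K) in *.
  assert (Hq : q * K = e / 2) by (unfold q; field; lra).
  pose proof (Cnorm_ge0 (g w - g z)%cx); pose proof (Cnorm_ge0 (f w - f z)%cx).
  assert (Cnorm (f w) * Cnorm (g w - g z)%cx <= K * q).
  { apply Rmult_le_compat; try lra; [apply Cnorm_ge0|unfold K; lra]. }
  assert (Cnorm (g z) * Cnorm (f w - f z)%cx <= Cnorm (g z) * q) by (apply Rmult_le_compat_l; lra).
  assert (Cnorm (g z) * q < K * q) by (apply Rmult_lt_compat_r; unfold K; lra).
  lra.
Qed.

Lemma cont_opp f z : cont_at f z -> cont_at (fun w => - f w)%cx z.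
Proof.
  intros Hf e He. destruct (Hf e He) as [d [P H]]. exists d; split; [assumption|].
  intros w Hw. replace (- f w - - f z)%cx with (- (f w - f z))%cx by ring.
  rewrite Cnorm_opp. auto.
Qed.

Lemma cont_sub f g z : cont_at f z -> cont_at g z -> cont_at (fun w => f w - g w)%cx z.
Proof. intros Hf Hg. apply (cont_add f (fun w => - g w)%cx); [assumption|now apply cont_opp]. Qed.

Lemma cont_pow f z k : cont_at f z -> cont_at (fun w => f w ^ k)%cx z.
Proof.
  intros Hf; induction k; simpl; [apply cont_const|now apply (cont_mul f (fun w => f w ^ k)%cx)].
Qed.

Lemma cont_comp f g z : cont_at f z -> cont_at g (f z) -> cont_at (fun w => g (f w)) z.
Proof.
  intros Hf Hg e He. destruct (Hg e He) as [d [P H]]. destruct (Hf d P) as [d' [P' H']].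
  exists d'; split; auto.
Qed.

Lemma cont_ext_loc f g z r : 0 < r -> (forall w, Cnorm (w - z)%cx < r -> f w = g w) ->
  cont_at f z -> cont_at g z.
Proof.
  intros Hr E Hf e He. destruct (Hf e He) as [d [P H]].
  exists (Rmin d r); split; [now apply Rmin_glb_lt|]. intros w Hw.
  pose proof (Rmin_l d r); pose proof (Rmin_r d r).
  rewrite <- !E; [apply H; lra| |lra]. rewrite Cnorm_sub_diag; lra.
Qed.

Lemma cont_nonzero f z : cont_at f z -> f z <> C0 ->
  exists delta, 0 < delta /\
    forall w, Cnorm (w - z)%cx < delta -> Cnorm (f z) / 2 < Cnorm (f w).
Proof.
  intros Hf Hz. pose proof (Cnorm_pos _ Hz).
  destruct (Hf (Cnorm (f z) / 2)) as [d [P H']]; [lra|]. exists d; split; [assumption|].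
  intros w Hw. specialize (H' w Hw). rewrite Cnorm_sub_sym in H'.
  pose proof (Cnorm_sub_ge (f z) (f w)). lra.
Qed.

Lemma cont_inv_id z : z <> C0 -> cont_at Cinv z.
Proof.
  intros Hz e He. pose proof (Cnorm_pos z Hz) as Np.
  destruct (cont_nonzero _ z (cont_id z) Hz) as [d [P H]].
  assert (Hd : 0 < e * (Cnorm z * Cnorm z / 2)).
  { apply Rmult_lt_0_compat; [lra|]. nra. }
  exists (Rmin d (e * (Cnorm z * Cnorm z / 2))); split; [now apply Rmin_glb_lt|].
  intros w Hw. pose proof (Rmin_l d (e * (Cnorm z * Cnorm z / 2))).
  pose proof (Rmin_r d (e * (Cnorm z * Cnorm z / 2))).
  assert (Hw' := H w ltac:(lra)).
  assert (Hwn : w <> C0) by (apply Cnorm_pos_neq0; lra).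
  replace (Cinv w - Cinv z)%cx with ((z - w) / (w * z))%cx by (field; auto).
  rewrite Cnorm_div, Cnorm_mul, Cnorm_sub_sym by now apply Cmul_neq0.
  apply Rmult_lt_reg_r with (Cnorm w * Cnorm z); [nra|].
  unfold Rdiv. rewrite Rmult_assoc, Rinv_l by (apply Rgt_not_eq; nra).
  rewrite Rmult_1_r. apply Rlt_trans with (e * (Cnorm z * Cnorm z / 2)); [lra|].
  apply Rmult_lt_compat_l; nra.
Qed.

Lemma cont_inv f z : cont_at f z -> f z <> C0 -> cont_at (fun w => Cinv (f w)) z.
Proof. intros Hf Hz. apply (cont_comp f Cinv); [assumption|now apply cont_inv_id]. Qed.

Lemma cont_div f g z : cont_at f z -> cont_at g z -> g z <> C0 ->
  cont_at (fun w => f w / g w)%cx z.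
Proof. intros. apply (cont_mul f (fun w => Cinv (g w))); [assumption|now apply cont_inv]. Qed.

Lemma cont_csum n (f : nat -> Cx -> Cx) z : (forall k, cont_at (f k) z) ->
  cont_at (fun w => Csum n (fun k => f k w)) z.
Proof.
  intros H; induction n; simpl; [apply cont_const|].
  now apply (cont_add (fun w => Csum n (fun k => f k w)) (f n)).
Qed.

(* Caratheodory's criterion; it turns the rules of differentiation into rules of continuity. *)
Lemma cderiv_slope f z L : is_cderiv f z L <->
  exists q, cont_at q z /\ q z = L /\ forall w, (f w - f z)%cx = (q w * (w - z))%cx.
Proof.
  split.
  - intros H.
    exists (fun w => if excluded_middle_informative (w = z) then L else (f w - f z) / (w - z))%cx.
    split; [|split].
    + intros e He. destruct (H (e / 2)) as [d [P Hd]]; [lra|]. exists d; split; [assumption|].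
      intros w Hw. destruct (excluded_middle_informative (z = z)) as [_|]; [|tauto].
      destruct (excluded_middle_informative (w = z)) as [_|Hn];
        [rewrite Cnorm_sub_diag; lra|].
      assert (Hs : (w - z)%cx <> C0) by (intros E; apply Hn, Csub_eq0, E).
      pose proof (Cnorm_pos _ Hs).
      replace ((f w - f z) / (w - z) - L)%cx with ((f w - f z - L * (w - z)) / (w - z))%cx
        by (field; exact Hs).
      rewrite Cnorm_div by exact Hs. apply Rmult_lt_reg_r with (Cnorm (w - z)%cx); [assumption|].
      unfold Rdiv. rewrite Rmult_assoc, Rinv_l, Rmult_1_r by lra.
      specialize (Hd w Hw). nra.
    + now destruct (excluded_middle_informative (z = z)).
    + intros w. destruct (excluded_middle_informative (w = z)) as [->|Hn]; [ring|].
      field. intros E; apply Hn, Csub_eq0, E.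
  - intros [q [Hq [<- E]]] e He. destruct (Hq e He) as [d [P Hd]]. exists d; split; [assumption|].
    intros w Hw. rewrite E. replace (q w * (w - z) - q z * (w - z))%cx
      with ((q w - q z) * (w - z))%cx by ring. rewrite Cnorm_mul.
    apply Rmult_le_compat_r; [apply Cnorm_ge0|]. left; auto.
Qed.

Definition cdiff (f : Cx -> Cx) (z : Cx) : Prop := exists L, is_cderiv f z L.

Lemma cdiff_cont f z : cdiff f z -> cont_at f z.
Proof.
  intros [L H]. apply cderiv_slope in H. destruct H as [q [Hq [_ E]]].
  apply (cont_ext_loc (fun w => f z + q w * (w - z))%cx f z 1); [lra| |].
  - intros w _. rewrite <- E. ring.
  - apply (cont_add (fun _ => f z)); [apply cont_const|].
    apply (cont_mul q); [assumption|]. apply (cont_sub (fun w => w)); [apply cont_id|apply cont_const].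
Qed.

Lemma cdiff_const a z : cdiff (fun _ => a) z.
Proof.
  exists C0. apply cderiv_slope. exists (fun _ => C0). repeat split; [apply cont_const|].
  intros; ring.
Qed.

Lemma cdiff_id z : cdiff (fun w => w) z.
Proof.
  exists C1. apply cderiv_slope. exists (fun _ => C1). repeat split; [apply cont_const|].
  intros; ring.
Qed.

Lemma cdiff_add f g z : cdiff f z -> cdiff g z -> cdiff (fun w => f w + g w)%cx z.
Proof.
  intros [L H] [M H']. apply cderiv_slope in H, H'.
  destruct H as [q [Hq [_ E]]]; destruct H' as [q' [Hq' [_ E']]].
  exists (q z + q' z)%cx. apply cderiv_slope. exists (fun w => q w + q' w)%cx.
  repeat split; [now apply cont_add|]. intros w.
  replace (f w + g w - (f z + g z))%cx with ((f w - f z) + (g w - g z))%cx by ring.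
  rewrite E, E'; ring.
Qed.

Lemma cdiff_mul f g z : cdiff f z -> cdiff g z -> cdiff (fun w => f w * g w)%cx z.
Proof.
  intros H H'. pose proof (cdiff_cont _ _ H') as Cg. destruct H as [L H], H' as [M H'].
  apply cderiv_slope in H, H'.
  destruct H as [q [Hq [_ E]]]; destruct H' as [q' [Hq' [_ E']]].
  exists (q z * g z + f z * q' z)%cx. apply cderiv_slope.
  exists (fun w => q w * g w + f z * q' w)%cx.
  repeat split.
  - apply (cont_add (fun w => q w * g w)%cx); [now apply cont_mul|].
    apply (cont_mul (fun _ => f z)); [apply cont_const|assumption].
  - intros w.
    replace (f w * g w - f z * g z)%cx with ((f w - f z) * g w + f z * (g w - g z))%cx by ring.
    rewrite E, E'; ring.
Qed.

Lemma cdiff_inv f z : cdiff f z -> f z <> C0 -> cdiff (fun w => Cinv (f w)) z.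
Proof.
  intros Hf Hz. pose proof (cdiff_cont _ _ Hf) as Cf.
  destruct (cont_nonzero f z Cf Hz) as [d [P Hd]].
  pose proof (Cnorm_pos _ Hz).
  destruct Hf as [L H0]. apply cderiv_slope in H0. destruct H0 as [q [Hq [_ E]]].
  exists (- q z / (f z * f z))%cx.
  (* The slope criterion asks for an identity at every [w], also where [f] vanishes. There the
     reciprocal is replaced by the expression that makes the identity true, which changes nothing
     near [z]. *)
  assert (K : is_cderiv (fun w => if excluded_middle_informative (f w = C0)
            then Cinv (f z) - q w / (f z * f z) * (w - z) else Cinv (f w))%cx z
            (- q z / (f z * f z))%cx).
  { apply cderiv_slope.
    exists (fun w => if excluded_middle_informative (f w = C0)
       then - q w / (f z * f z) else - q w / (f w * f z))%cx.
    destruct (excluded_middle_informative (f z = C0)); [contradiction|].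
    repeat split.
    - apply (cont_ext_loc (fun w => - q w / (f w * f z))%cx _ z d); [assumption| |].
      + intros w Hw. specialize (Hd w Hw).
        destruct (excluded_middle_informative (f w = C0)) as [Z|]; [|reflexivity].
        rewrite Z, Cnorm_C0 in Hd; lra.
      + apply (cont_div (fun w => - q w)%cx); [now apply cont_opp| |now apply Cmul_neq0].
        apply (cont_mul f); [assumption|apply cont_const].
    - intros w. destruct (excluded_middle_informative (f w = C0)) as [Z|Hw].
      + field; assumption.
      + replace (Cinv (f w) - Cinv (f z))%cx with (- (f w - f z) / (f w * f z))%cx by (field; auto).
        rewrite E. field; auto. }
  intros e He. destruct (K e He) as [d' [P' Hd']].
  exists (Rmin d d'); split; [now apply Rmin_glb_lt|]. intros w Hw.
  pose proof (Rmin_l d d'); pose proof (Rmin_r d d').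
  specialize (Hd' w ltac:(lra)). specialize (Hd w ltac:(lra)). cbv beta in Hd'.
  destruct (excluded_middle_informative (f z = C0)); [contradiction|].
  destruct (excluded_middle_informative (f w = C0)) as [Z|]; [|assumption].
  rewrite Z, Cnorm_C0 in Hd; lra.
Qed.

Lemma cdiff_div f g z : cdiff f z -> cdiff g z -> g z <> C0 ->
  cdiff (fun w => f w / g w)%cx z.
Proof. intros. apply (cdiff_mul f (fun w => Cinv (g w))); [assumption|now apply cdiff_inv]. Qed.

Lemma cdiff_comp f g z : cdiff f z -> cdiff g (f z) -> cdiff (fun w => g (f w)) z.
Proof.
  intros Hf [M HM]. pose proof (cdiff_cont _ _ Hf) as Cf. destruct Hf as [L HL].
  apply cderiv_slope in HL, HM.
  destruct HL as [q [Hq [_ E]]]; destruct HM as [q' [Hq' [_ E']]].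
  exists (q' (f z) * q z)%cx. apply cderiv_slope. exists (fun w => q' (f w) * q w)%cx.
  repeat split.
  - apply (cont_mul (fun w => q' (f w))); [now apply (cont_comp f q')|assumption].
  - intros w. rewrite E', E. ring.
Qed.

Lemma cdiff_ext_loc f g z r : 0 < r -> (forall w, Cnorm (w - z)%cx < r -> f w = g w) ->
  cdiff f z -> cdiff g z.
Proof.
  intros Hr E [L HL]. exists L. intros e He. destruct (HL e He) as [d [P H]].
  exists (Rmin d r); split; [now apply Rmin_glb_lt|]. intros w Hw.
  pose proof (Rmin_l d r); pose proof (Rmin_r d r).
  rewrite <- !E; [apply H; lra| |lra]. rewrite Cnorm_sub_diag; lra.
Qed.

Lemma cdiff_pow f z k : cdiff f z -> cdiff (fun w => f w ^ k)%cx z.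
Proof.
  intros Hf; induction k; simpl; [apply cdiff_const|now apply (cdiff_mul f (fun w => f w ^ k)%cx)].
Qed.

Lemma cdiff_sub f g z : cdiff f z -> cdiff g z -> cdiff (fun w => f w - g w)%cx z.
Proof.
  intros Hf Hg.
  apply (cdiff_ext_loc (fun w => f w + (- C1) * g w)%cx _ z 1); [lra|intros; ring|].
  apply (cdiff_add f); [assumption|]. apply (cdiff_mul (fun _ => - C1)%cx); [apply cdiff_const|assumption].
Qed.

Lemma cdiff_csum n (f : nat -> Cx -> Cx) z : (forall k, cdiff (f k) z) ->
  cdiff (fun w => Csum n (fun k => f k w)) z.
Proof.
  intros H; induction n; simpl; [apply cdiff_const|].
  now apply (cdiff_add (fun w => Csum n (fun k => f k w)) (f n)).
Qed.

Lemma cdiff_disk_ext f g z : Disk z -> (forall w, Disk w -> f w = g w) -> cdiff f z -> cdiff g z.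
Proof.
  intros Hz E. destruct (Disk_open z Hz) as [r [P H]].
  apply (cdiff_ext_loc f g z r); auto.
Qed.

(** * Finite sums *)

Lemma Csum_ext n f g : (forall k, (k < n)%nat -> f k = g k) -> Csum n f = Csum n g.
Proof.
  induction n; simpl; intros H; [reflexivity|]. rewrite H, IHn by auto. reflexivity.
Qed.

Lemma Csum_add n f g : Csum n (fun k => f k + g k)%cx = (Csum n f + Csum n g)%cx.
Proof. induction n; simpl; [ring|rewrite IHn; ring]. Qed.

Lemma Csum_scal n a f : Csum n (fun k => a * f k)%cx = (a * Csum n f)%cx.
Proof. induction n; simpl; [ring|rewrite IHn; ring]. Qed.

Lemma Csum_zero n f : (forall k, (k < n)%nat -> f k = C0) -> Csum n f = C0.
Proof. induction n; simpl; intros H; [reflexivity|]. rewrite H, IHn by auto. ring. Qed.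

Lemma Csum_split n j f : (j <= n)%nat ->
  Csum n f = (Csum j f + Csum (n - j) (fun k => f (j + k)%nat))%cx.
Proof.
  intros H. induction n as [|n IH].
  - replace j with O by lia. simpl; ring.
  - destruct (Nat.eq_dec j (S n)) as [->|Hj].
    + rewrite Nat.sub_diag. simpl. ring.
    + rewrite Nat.sub_succ_l by lia. simpl. rewrite IH by lia.
      replace (j + (n - j))%nat with n by lia. ring.
Qed.

(** * Bisection of rectangles *)

Lemma nested_intervals (x y : nat -> R) :
  (forall k, x k <= x (S k)) -> (forall k, y (S k) <= y k) -> (forall k, x k <= y k) ->
  exists s, forall k, x k <= s <= y k.
Proof.
  intros Hx Hy Hxy.
  assert (Mx : forall j k, (j <= k)%nat -> x j <= x k).
  { intros j k H; induction H; [lra|]. specialize (Hx m); lra. }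
  assert (My : forall j k, (j <= k)%nat -> y k <= y j).
  { intros j k H; induction H; [lra|]. specialize (Hy m); lra. }
  assert (A : forall j k, x j <= y k).
  { intros j k. destruct (Nat.le_ge_cases j k) as [H|H].
    - apply Rle_trans with (x k); auto.
    - apply Rle_trans with (y j); auto. }
  destruct (completeness (fun r => exists k, r = x k)) as [s [U L]].
  - exists (y 0%nat). intros r [k ->]; auto.
  - exists (x 0%nat), 0%nat; reflexivity.
  - exists s. intros k; split; [apply U; now exists k|]. apply L. intros r [j ->]; auto.
Qed.

Section Bisection.

Variable P : R -> R -> R -> R -> Prop.

(** [P] is abstract because bisection serves two purposes: rectangles of large circulation in
    Goursat's lemma, and rectangles cofinal for a function on a closed ball. The last quarter is the
    default case; [Pstep] guarantees that [P] holds there when the other three fail. *)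
Definition quarter_step (q : R * R * R * R) : R * R * R * R :=
  let '(a, b, c, d) := q in
  let s := (a + b) / 2 in let t := (c + d) / 2 in
  if excluded_middle_informative (P a s c t) then (a, s, c, t)
  else if excluded_middle_informative (P a s t d) then (a, s, t, d)
  else if excluded_middle_informative (P s b c t) then (s, b, c, t)
  else (s, b, t, d).

Variables a b c d : R.
Hypothesis Hab : a < b.
Hypothesis Hcd : c < d.
Hypothesis P0 : P a b c d.
Hypothesis Pstep : forall a b c d, a < b -> c < d -> P a b c d ->
  let s := (a + b) / 2 in let t := (c + d) / 2 in
  P a s c t \/ P a s t d \/ P s b c t \/ P s b t d.

Fixpoint quarter_seq (k : nat) : R * R * R * R :=
  match k with O => (a, b, c, d) | S k' => quarter_step (quarter_seq k') end.

Let ak k := let '(x, _, _, _) := quarter_seq k in x.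
Let bk k := let '(_, x, _, _) := quarter_seq k in x.
Let ck k := let '(_, _, x, _) := quarter_seq k in x.
Let dk k := let '(_, _, _, x) := quarter_seq k in x.

Lemma quarter_seq_spec k :
  P (ak k) (bk k) (ck k) (dk k) /\
  bk k - ak k = (b - a) / 2 ^ k /\ dk k - ck k = (d - c) / 2 ^ k /\
  ak k <= ak (S k) /\ bk (S k) <= bk k /\ ck k <= ck (S k) /\ dk (S k) <= dk k.
Proof.
  assert (H : forall k, P (ak k) (bk k) (ck k) (dk k) /\
     bk k - ak k = (b - a) / 2 ^ k /\ dk k - ck k = (d - c) / 2 ^ k).
  { clear k. intros k; induction k as [|k [IP [IL IM]]].
    - unfold ak, bk, ck, dk; simpl. repeat split; [assumption|field|field].
    - assert (H2 : 0 < 2 ^ k) by (apply pow_lt; lra).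
      assert (0 < (b - a) / 2 ^ k) by (apply Rdiv_lt_0_compat; lra).
      assert (0 < (d - c) / 2 ^ k) by (apply Rdiv_lt_0_compat; lra).
      unfold ak, bk, ck, dk in *; simpl.
      destruct (quarter_seq k) as [[[a' b'] c'] d'] eqn:E.
      pose proof (Pstep a' b' c' d' ltac:(lra) ltac:(lra) IP) as S. simpl in S.
      assert (HL : forall x, x / (2 * 2 ^ k) = x / 2 ^ k / 2) by (intros; field; lra).
      rewrite !HL, <- IL, <- IM. unfold quarter_step.
      repeat destruct excluded_middle_informative; repeat split; try lra; tauto. }
  destruct (H k) as [H1 [H2 H3]]. repeat split; try assumption.
  all: assert (H4 : 0 < 2 ^ k) by (apply pow_lt; lra).
  all: assert (0 < (b - a) / 2 ^ k) by (apply Rdiv_lt_0_compat; lra).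
  all: assert (0 < (d - c) / 2 ^ k) by (apply Rdiv_lt_0_compat; lra).
  all: unfold ak, bk, ck, dk in *; simpl.
  all: destruct (quarter_seq k) as [[[a' b'] c'] d'] eqn:E; unfold quarter_step.
  all: repeat destruct excluded_middle_informative; lra.
Qed.

Lemma bisection_point : exists s t, a <= s <= b /\ c <= t <= d /\
  forall k, exists a' b' c' d', P a' b' c' d' /\
    b' - a' = (b - a) / 2 ^ k /\ d' - c' = (d - c) / 2 ^ k /\
    a' <= s <= b' /\ c' <= t <= d'.
Proof.
  pose proof quarter_seq_spec as Q.
  assert (Pk : forall k, 0 < 2 ^ k) by (intros; apply pow_lt; lra).
  destruct (nested_intervals ak bk) as [s Hs].
  1, 2: intros k; apply (Q k).
  { intros k; destruct (Q k) as [_ [H _]]. pose proof (Pk k).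
    assert (0 < (b - a) / 2 ^ k) by (apply Rdiv_lt_0_compat; lra). lra. }
  destruct (nested_intervals ck dk) as [t Ht].
  1, 2: intros k; apply (Q k).
  { intros k; destruct (Q k) as [_ [_ [H _]]]. pose proof (Pk k).
    assert (0 < (d - c) / 2 ^ k) by (apply Rdiv_lt_0_compat; lra). lra. }
  exists s, t. split; [exact (Hs 0%nat)|]. split; [exact (Ht 0%nat)|].
  intros k. exists (ak k), (bk k), (ck k), (dk k). destruct (Q k) as [H1 [H2 [H3 _]]].
  repeat split; try assumption; apply Hs || apply Ht.
Qed.

End Bisection.

Lemma half_pow_small x e : 0 < e -> exists k, x / 2 ^ k < e.
Proof.
  intros He. assert (A : Rabs (1 / 2) < 1) by (rewrite Rabs_pos_eq; lra).
  destruct (pow_lt_1_zero (1 / 2) A (e / (Rabs x + 1))) as [k Hk].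
  { pose proof (Rabs_pos x). apply Rdiv_lt_0_compat; lra. }
  exists k. specialize (Hk k (Nat.le_refl k)).
  assert (P : 0 < 2 ^ k) by (apply pow_lt; lra).
  assert (E : (1 / 2) ^ k = / 2 ^ k).
  { unfold Rdiv. rewrite Rmult_1_l, pow_inv; lra. }
  rewrite E in Hk. pose proof (Rinv_0_lt_compat _ P) as Pi.
  rewrite Rabs_pos_eq in Hk by lra. pose proof (Rabs_pos x) as Ax.
  unfold Rdiv. apply Rle_lt_trans with ((Rabs x + 1) * / 2 ^ k).
  - pose proof (Rle_abs x). nra.
  - apply Rmult_lt_compat_l with (r := Rabs x + 1) in Hk; [|lra].
    replace ((Rabs x + 1) * (e / (Rabs x + 1))) with e in Hk by (field; lra). exact Hk.
Qed.

(** * Goursat's lemma *)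

(** Total real differentiability with the Jacobian of multiplication by [A + i B]. Cauchy-Riemann
    equations for partial derivatives alone would not give the uniform error that Goursat's local
    estimate needs. *)
Definition CR_at (U V : R -> R -> R) (s t : R) : Prop :=
  exists A B, forall eps, 0 < eps -> exists delta, 0 < delta /\
    forall s' t', Rabs (s' - s) < delta -> Rabs (t' - t) < delta ->
      Rabs (U s' t' - U s t - (A * (s' - s) - B * (t' - t))) <= eps * (Rabs (s' - s) + Rabs (t' - t)) /\
      Rabs (V s' t' - V s t - (B * (s' - s) + A * (t' - t))) <= eps * (Rabs (s' - s) + Rabs (t' - t)).

Lemma continuous_eps (f : R -> R) x :
  (forall e, 0 < e -> exists d, 0 < d /\ forall y, Rabs (y - x) < d -> Rabs (f y - f x) < e) ->
  continuous f x.
Proof.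
  intros H. apply continuity_pt_filterlim. intros e He.
  destruct (H e He) as [d [P Hd]]. exists d; split; [assumption|].
  intros y [_ Hy]. apply Hd. exact Hy.
Qed.

Lemma CR_continuous U V s t : CR_at U V s t ->
  continuous (U s) t /\ continuous (fun s => V s t) s.
Proof.
  intros [A [B H]]. destruct (H 1) as [d [P Hd]]; [lra|].
  assert (Ke : forall K e, 0 < e -> 0 <= K -> exists d', 0 < d' <= d /\ d' * (K + 1) <= e).
  { intros K e He HK. exists (Rmin d (e / (K + 1))).
    assert (0 < e / (K + 1)) by (apply Rdiv_lt_0_compat; lra).
    split; [split; [now apply Rmin_glb_lt|apply Rmin_l]|].
    apply Rle_trans with (e / (K + 1) * (K + 1)); [|right; field; lra].
    apply Rmult_le_compat_r; [lra|apply Rmin_r]. }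
  split; apply continuous_eps; intros e He.
  - destruct (Ke (Rabs B) e He (Rabs_pos _)) as [d' [[P1 P2] P3]].
    exists d'; split; [assumption|]. intros y Hy.
    destruct (Hd s y) as [H1 _]; [rewrite Rminus_diag, Rabs_R0; lra|lra|].
    rewrite Rminus_diag, Rabs_R0 in H1.
    replace (U s y - U s t) with ((U s y - U s t - (A * 0 - B * (y - t))) + - (B * (y - t))) by ring.
    eapply Rle_lt_trans; [apply Rabs_triang|]. rewrite Rabs_Ropp, Rabs_mult.
    pose proof (Rabs_pos B); pose proof (Rabs_pos (y - t)). nra.
  - destruct (Ke (Rabs B) e He (Rabs_pos _)) as [d' [[P1 P2] P3]].
    exists d'; split; [assumption|]. intros y Hy.
    destruct (Hd y t) as [_ H1]; [lra|rewrite Rminus_diag, Rabs_R0; lra|].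
    rewrite Rminus_diag, Rabs_R0 in H1.
    replace (V y t - V s t) with ((V y t - V s t - (B * (y - s) + A * 0)) + (B * (y - s))) by ring.
    eapply Rle_lt_trans; [apply Rabs_triang|]. rewrite Rabs_mult.
    pose proof (Rabs_pos B); pose proof (Rabs_pos (y - s)). nra.
Qed.

Lemma RInt_near_const (g : R -> R) c d K e : c <= d -> ex_RInt g c d ->
  (forall t, c <= t <= d -> Rabs (g t - K) <= e) ->
  Rabs (RInt g c d - K * (d - c)) <= e * (d - c).
Proof.
  intros Hcd Hg H.
  assert (L : forall x : R, RInt (fun _ => x) c d = (d - c) * x)
    by (intros x; exact (RInt_const c d x)).
  assert (H1 : RInt (fun _ => K - e) c d <= RInt g c d).
  { apply RInt_le; [assumption|apply ex_RInt_const|assumption|].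
    intros t Ht. assert (B := H t ltac:(lra)). apply Rabs_le_between in B. lra. }
  assert (H2 : RInt g c d <= RInt (fun _ => K + e) c d).
  { apply RInt_le; [assumption|assumption|apply ex_RInt_const|].
    intros t Ht. assert (B := H t ltac:(lra)). apply Rabs_le_between in B. lra. }
  rewrite L in H1, H2. apply Rabs_le. lra.
Qed.

Lemma RInt_minus_R (f g : R -> R) a b : ex_RInt f a b -> ex_RInt g a b ->
  RInt f a b - RInt g a b = RInt (fun x => f x - g x) a b.
Proof. intros Hf Hg. symmetry. exact (RInt_minus f g a b Hf Hg). Qed.

Lemma ex_RInt_minus_R (f g : R -> R) a b : ex_RInt f a b -> ex_RInt g a b ->
  ex_RInt (fun x => f x - g x) a b.
Proof. intros Hf Hg. exact (ex_RInt_minus f g a b Hf Hg). Qed.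

Section Goursat.

Variables (U V : R -> R -> R) (M : R).
Hypothesis HCR : forall s t, s < M -> CR_at U V s t.

(** The imaginary part of the contour integral of [U + i V] around the rectangle; in this part the
    vertical sides carry [U]. The domain [s < M] is the logarithmic picture of a punctured disk of
    radius [exp M]. *)
Definition circulation (a b c d : R) : R :=
  (RInt (U b) c d - RInt (U a) c d) - (RInt (fun s => V s d) a b - RInt (fun s => V s c) a b).

Lemma ex_RInt_vert s c d : s < M -> ex_RInt (U s) c d.
Proof.
  intros Hs. apply (ex_RInt_continuous (V := R_CompleteNormedModule)). intros t _.
  now apply (CR_continuous U V s t), HCR.
Qed.

Lemma ex_RInt_horiz t a b : a < M -> b < M -> ex_RInt (fun s => V s t) a b.
Proof.
  intros Ha Hb. apply (ex_RInt_continuous (V := R_CompleteNormedModule)). intros s Hs.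
  apply (CR_continuous U V s t), HCR. assert (Rmax a b < M) by now apply Rmax_lub_lt. lra.
Qed.

Lemma circulation_split a b c d s t : a < M -> s < M -> b < M ->
  circulation a b c d = circulation a s c t + circulation a s t d
                        + circulation s b c t + circulation s b t d.
Proof.
  intros Ha Hs Hb. unfold circulation.
  rewrite <- (RInt_Chasles (U b) c t d) by now apply ex_RInt_vert.
  rewrite <- (RInt_Chasles (U a) c t d) by now apply ex_RInt_vert.
  rewrite <- (RInt_Chasles (fun x => V x d) a s b) by now apply ex_RInt_horiz.
  rewrite <- (RInt_Chasles (fun x => V x c) a s b) by now apply ex_RInt_horiz.
  unfold plus; simpl. ring.
Qed.

(** For the affine part of [U + i V] both differences integrate to [A * (b - a) * (d - c)] and
    cancel. Only the differentiability error survives, twice [eps / 2] on each pair of opposite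
    sides. *)
Lemma circulation_local s t eps : s < M -> 0 < eps -> exists delta, 0 < delta /\
  forall a b c d, a <= s <= b -> c <= t <= d -> b < M -> b - a < delta -> d - c < delta ->
    Rabs (circulation a b c d) <= eps * ((b - a) + (d - c)) * ((b - a) + (d - c)).
Proof.
  intros Hs He. destruct (HCR s t Hs) as [A [B H]].
  destruct (H (eps / 2)) as [dl [P Hd]]; [lra|]. exists dl; split; [assumption|].
  intros a b c d Hab Hcd Hb Lab Lcd. unfold circulation.
  set (D := (b - a) + (d - c)).
  assert (E : forall s' t', a <= s' <= b -> c <= t' <= d ->
     Rabs (U s' t' - U s t - (A * (s' - s) - B * (t' - t))) <= eps / 2 * D /\
     Rabs (V s' t' - V s t - (B * (s' - s) + A * (t' - t))) <= eps / 2 * D).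
  { intros s' t' H1 H2.
    assert (B1 : Rabs (s' - s) <= b - a) by (apply Rabs_le; lra).
    assert (B2 : Rabs (t' - t) <= d - c) by (apply Rabs_le; lra).
    destruct (Hd s' t') as [E1 E2]; [lra|lra|].
    split; (eapply Rle_trans; [eassumption|]); apply Rmult_le_compat_l; unfold D; lra. }
  rewrite RInt_minus_R by (apply ex_RInt_vert; lra).
  rewrite RInt_minus_R by (apply ex_RInt_horiz; lra).
  assert (N1 : Rabs (RInt (fun x => U b x - U a x) c d - A * (b - a) * (d - c)) <= eps * D * (d - c)).
  { apply RInt_near_const; [lra|apply ex_RInt_minus_R; apply ex_RInt_vert; lra|].
    intros x Hx. destruct (E b x) as [E1 _]; [lra|lra|]. destruct (E a x) as [E2 _]; [lra|lra|].
    apply Rabs_le_between in E1, E2. apply Rabs_le. lra. }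
  assert (N2 : Rabs (RInt (fun x => V x d - V x c) a b - A * (d - c) * (b - a)) <= eps * D * (b - a)).
  { apply RInt_near_const; [lra|apply ex_RInt_minus_R; apply ex_RInt_horiz; lra|].
    intros x Hx. destruct (E x d) as [_ E1]; [lra|lra|]. destruct (E x c) as [_ E2]; [lra|lra|].
    apply Rabs_le_between in E1, E2. apply Rabs_le. lra. }
  apply Rabs_le_between in N1, N2. apply Rabs_le. unfold D in *. lra.
Qed.

(** Areas add up over the four quarters, so a circulation exceeding [eta] times the area is
    inherited by one of them. At the limit point this contradicts the local bound, which is small
    compared with the square of the side lengths. Taking half the actual density for [eta] makes the
    initial inequality strict. *)
Lemma goursat a b c d : a < b -> b < M -> c < d -> circulation a b c d = 0.
Proof.
  intros Hab Hb Hcd. apply NNPP; intros Hne.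
  set (eta := Rabs (circulation a b c d) / (2 * ((b - a) * (d - c)))).
  assert (Har : 0 < (b - a) * (d - c)) by nra.
  assert (Hc : 0 < Rabs (circulation a b c d)) by now apply Rabs_pos_lt.
  assert (Heta : 0 < eta) by (apply Rdiv_lt_0_compat; lra).
  set (P := fun a b c d => b < M /\ eta * ((b - a) * (d - c)) < Rabs (circulation a b c d)).
  destruct (bisection_point P a b c d Hab Hcd) as [s [t [Hs [Ht Hk]]]].
  { split; [assumption|]. unfold eta.
    replace (Rabs (circulation a b c d) / (2 * ((b - a) * (d - c))) * ((b - a) * (d - c)))
      with (Rabs (circulation a b c d) / 2) by (field; lra). lra. }
  { intros a' b' c' d' Ha' Hc' [Hb' Hp] s t. apply NNPP; intros N.
    assert (Hs : s < b') by (unfold s; lra).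
    rewrite (circulation_split a' b' c' d' s t) in Hp by lra.
    assert (Q : forall x1 x2 y1 y2, x2 < M ->
       ~ P x1 x2 y1 y2 -> Rabs (circulation x1 x2 y1 y2) <= eta * ((x2 - x1) * (y2 - y1))).
    { intros x1 x2 y1 y2 Hx HP. apply Rnot_lt_le. intros HH; apply HP; now split. }
    pose proof (Q a' s c' t ltac:(lra) ltac:(tauto)).
    pose proof (Q a' s t d' ltac:(lra) ltac:(tauto)).
    pose proof (Q s b' c' t ltac:(lra) ltac:(tauto)).
    pose proof (Q s b' t d' ltac:(lra) ltac:(tauto)).
    pose proof (Rabs_triang (circulation a' s c' t + circulation a' s t d' + circulation s b' c' t)
                 (circulation s b' t d')).
    pose proof (Rabs_triang (circulation a' s c' t + circulation a' s t d') (circulation s b' c' t)).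
    pose proof (Rabs_triang (circulation a' s c' t) (circulation a' s t d')).
    assert (eta * ((b' - a') * (d' - c')) =
      eta * ((s - a') * (t - c')) + eta * ((s - a') * (d' - t))
      + eta * ((b' - s) * (t - c')) + eta * ((b' - s) * (d' - t))) by ring.
    lra. }
  set (D := (b - a) + (d - c)).
  assert (HD : 0 < D) by (unfold D; lra).
  (* All rectangles of the sequence are similar, so area over squared half-perimeter is constant;
     this [eps] turns the local bound into exactly [eta] times the area. *)
  set (eps := eta * ((b - a) * (d - c)) / (D * D)).
  assert (Heps : 0 < eps) by (apply Rdiv_lt_0_compat; nra).
  destruct (circulation_local s t eps ltac:(lra) Heps) as [dl [Pd Hd]].
  destruct (half_pow_small D dl Pd) as [k Hkd].
  destruct (Hk k) as [a' [b' [c' [d' [[HbM HP] [E1 [E2 [S1 S2]]]]]]]].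
  assert (P2 : 0 < 2 ^ k) by (apply pow_lt; lra).
  assert (ED : D / 2 ^ k = (b' - a') + (d' - c')) by (rewrite E1, E2; unfold D; field; lra).
  assert (X := Hd a' b' c' d' S1 S2 HbM ltac:(lra) ltac:(lra)).
  rewrite <- ED in X. rewrite E1, E2 in HP.
  assert (eps * (D / 2 ^ k) * (D / 2 ^ k) = eta * ((b - a) / 2 ^ k * ((d - c) / 2 ^ k))).
  { unfold eps. field. lra. }
  lra.
Qed.

Lemma vertical_integral_const a b c d : a < b -> b < M -> c < d ->
  (forall s, V s d = V s c) -> RInt (U a) c d = RInt (U b) c d.
Proof.
  intros Hab Hb Hcd Hper. pose proof (goursat a b c d Hab Hb Hcd) as G. unfold circulation in G.
  rewrite (RInt_ext (fun s => V s d) (fun s => V s c)) in G by (intros; apply Hper). lra.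
Qed.

End Goursat.

(** * The mean value inequality on circles *)

Definition cexp (z : Cx) : Cx := (exp (fst z) * cos (snd z), exp (fst z) * sin (snd z)).

Lemma cexp_add z w : cexp (z + w)%cx = (cexp z * cexp w)%cx.
Proof. apply Cx_ext; simpl; rewrite exp_plus, ?cos_plus, ?sin_plus; ring. Qed.

Lemma Cnorm_cexp z : Cnorm (cexp z) = exp (fst z).
Proof.
  pose proof (exp_pos (fst z)). apply Cnorm_unique; [lra|]. simpl.
  pose proof (sin2_cos2 (snd z)) as H1. unfold Rsqr in H1. nra.
Qed.

Lemma derivable_pt_lim_affine f l : derivable_pt_lim f 0 l ->
  forall e, 0 < e -> exists d, 0 < d /\
    forall h, Rabs h < d -> Rabs (f h - f 0 - l * h) <= e * Rabs h.
Proof.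
  intros H e He. destruct (H e He) as [d Hd]. exists d; split; [apply cond_pos|].
  intros h Hh. destruct (Req_dec h 0) as [->|Hn].
  - rewrite Rmult_0_r, Rminus_0_r, Rminus_diag, Rabs_R0; lra.
  - specialize (Hd h Hn Hh). rewrite Rplus_0_l in Hd.
    replace (f h - f 0 - l * h) with (((f h - f 0) / h - l) * h) by (field; assumption).
    rewrite Rabs_mult. apply Rmult_le_compat_r; [apply Rabs_pos|lra].
Qed.

Lemma cdiff_cexp_0 : cdiff cexp C0.
Proof.
  (* The two components contribute errors of [1 + 3] and [3 + 2] times [e * N], nine in all. The
     bound [e <= 1] serves to get [Rabs (exp x) <= 3]. *)
  exists C1. intros e0 He0. set (e := Rmin (e0 / 10) 1).
  assert (He : 0 < e) by (apply Rmin_glb_lt; lra).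
  assert (e <= e0 / 10) by apply Rmin_l. assert (e <= 1) by apply Rmin_r. clearbody e.
  destruct (derivable_pt_lim_affine exp 1) with (e := e) as [d1 [P1 H1]]; [|assumption|].
  { rewrite <- exp_0. apply derivable_pt_lim_exp. }
  destruct (derivable_pt_lim_affine cos 0) with (e := e) as [d2 [P2 H2]]; [|assumption|].
  { replace 0 with (- sin 0) at 2 by (rewrite sin_0; ring). apply derivable_pt_lim_cos. }
  destruct (derivable_pt_lim_affine sin 1) with (e := e) as [d3 [P3 H3]]; [|assumption|].
  { rewrite <- cos_0. apply derivable_pt_lim_sin. }
  exists (Rmin (Rmin d1 d2) (Rmin d3 e)). split; [repeat apply Rmin_glb_lt; assumption|].
  intros w Hw.
  pose proof (Rmin_l (Rmin d1 d2) (Rmin d3 e)); pose proof (Rmin_r (Rmin d1 d2) (Rmin d3 e)).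
  pose proof (Rmin_l d1 d2); pose proof (Rmin_r d1 d2).
  pose proof (Rmin_l d3 e); pose proof (Rmin_r d3 e).
  replace (w - C0)%cx with w in * by ring. destruct w as [x y].
  pose proof (Cnorm_fst (x, y)) as Nx; pose proof (Cnorm_snd (x, y)) as Ny. simpl in Nx, Ny.
  specialize (H1 x ltac:(lra)). specialize (H2 y ltac:(lra)). specialize (H3 y ltac:(lra)).
  rewrite exp_0 in H1. rewrite cos_0 in H2. rewrite sin_0 in H3.
  eapply Rle_trans; [apply Cnorm_le_sum|].
  unfold cexp; simpl. rewrite exp_0, cos_0, sin_0.
  set (X := exp x - 1 - 1 * x) in *. set (Y := cos y - 1 - 0 * y) in *.
  set (Z := sin y - 0 - 1 * y) in *.
  set (N := Cnorm (x, y)) in *.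
  pose proof (Rabs_pos x); pose proof (Rabs_pos y).
  assert (EX : exp x = 1 + x + X) by (unfold X; ring).
  assert (BX : Rabs (exp x) <= 3).
  { rewrite EX. pose proof (Rabs_triang (1 + x) X); pose proof (Rabs_triang 1 x).
    rewrite Rabs_R1 in *. nra. }
  assert (BX1 : Rabs (exp x - 1) <= 2 * Rabs x).
  { replace (exp x - 1) with (x + X) by (rewrite EX; ring).
    pose proof (Rabs_triang x X). nra. }
  replace (exp x * cos y + - (1 * 1) + - (1 * x - 0 * y)) with (X + exp x * Y)
    by (unfold X, Y; ring).
  replace (exp x * sin y + - (1 * 0) + - (1 * y + 0 * x)) with (exp x * Z + (exp x - 1) * y)
    by (unfold Z; ring).
  pose proof (Rabs_triang X (exp x * Y)) as T1.
  pose proof (Rabs_triang (exp x * Z) ((exp x - 1) * y)) as T2.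
  rewrite Rabs_mult in T1. rewrite (Rabs_mult (exp x)), (Rabs_mult (exp x - 1)) in T2.
  assert (HN : 0 <= N) by apply Cnorm_ge0.
  pose proof (Rabs_pos Y); pose proof (Rabs_pos Z); pose proof (Rabs_pos (exp x)).
  pose proof (Rabs_pos (exp x - 1)).
  assert (Rabs X <= e * N) by nra. assert (Rabs Y <= e * N) by nra.
  assert (Rabs Z <= e * N) by nra.
  assert (Rabs (exp x) * Rabs Y <= 3 * (e * N)) by (apply Rmult_le_compat; lra).
  assert (Rabs (exp x) * Rabs Z <= 3 * (e * N)) by (apply Rmult_le_compat; lra).
  assert (Rabs (exp x - 1) * Rabs y <= (2 * e) * N) by (apply Rmult_le_compat; lra).
  assert (e * N <= e0 / 10 * N) by (apply Rmult_le_compat_r; lra).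
  assert (0 <= e0 * N) by (apply Rmult_le_pos; lra).
  lra.
Qed.

Lemma cdiff_cexp z : cdiff cexp z.
Proof.
  apply (cdiff_ext_loc (fun w => cexp z * cexp (w - z))%cx cexp z 1); [lra| |].
  - intros w _. rewrite <- cexp_add. f_equal. ring.
  - apply (cdiff_mul (fun _ => cexp z)); [apply cdiff_const|].
    apply (cdiff_comp (fun w => w - z)%cx cexp).
    + apply (cdiff_sub (fun w => w)); [apply cdiff_id|apply cdiff_const].
    + rewrite Csub_diag. apply cdiff_cexp_0.
Qed.

Lemma cdiff_CR F s t : cdiff F (s, t) ->
  CR_at (fun s t => fst (F (s, t))) (fun s t => snd (F (s, t))) s t.
Proof.
  intros [L H]. exists (fst L), (snd L). intros e He. destruct (H e He) as [d [P Hd]].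
  exists (d / 2); split; [lra|]. intros s' t' H1 H2.
  pose proof (Cnorm_le_sum ((s', t') - (s, t))%cx) as N. simpl in N. fold (s' - s) (t' - t) in N.
  specialize (Hd (s', t') ltac:(lra)).
  pose proof (Cnorm_fst (F (s', t') - F (s, t) - L * ((s', t') - (s, t)))%cx) as N1.
  pose proof (Cnorm_snd (F (s', t') - F (s, t) - L * ((s', t') - (s, t)))%cx) as N2.
  assert (e * Cnorm ((s', t') - (s, t))%cx <= e * (Rabs (s' - s) + Rabs (t' - t)))
    by (apply Rmult_le_compat_l; lra).
  split.
  - eapply Rle_trans; [|eassumption]. eapply Rle_trans; [|exact Hd].
    eapply Rle_trans; [|exact N1]. right. apply (f_equal Rabs). simpl. ring.
  - eapply Rle_trans; [|eassumption]. eapply Rle_trans; [|exact Hd].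
    eapply Rle_trans; [|exact N2]. right. apply (f_equal Rabs). simpl. ring.
Qed.

(* In the coordinate w = c + exp (s + i t) the circles around c are vertical segments, and the
   horizontal sides of the rectangle 0 <= t <= 2 pi cancel by periodicity; differentiability at c
   itself is therefore not needed. *)
Lemma circle_mean_not_below H c rho r delta : 0 < r < rho -> cont_at H c ->
  (forall w, 0 < Cnorm (w - c)%cx < rho -> cdiff H w) -> 0 < delta ->
  ~ (forall w, Cnorm (w - c)%cx = r -> fst (H w) <= fst (H c) - delta).
Proof.
  intros Hr Hc Hd Pd Hbad.
  set (F := fun z => H (c + cexp z)%cx).
  assert (HE : forall z, Cnorm (c + cexp z - c)%cx = exp (fst z)).
  { intros z. rewrite <- Cnorm_cexp. f_equal. ring. }
  assert (HCR : forall s t, s < ln rho ->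
     CR_at (fun s t => fst (F (s, t))) (fun s t => snd (F (s, t))) s t).
  { intros s t Hs. apply cdiff_CR. unfold F. apply (cdiff_comp (fun z => c + cexp z)%cx H).
    - apply (cdiff_add (fun _ => c)); [apply cdiff_const|apply cdiff_cexp].
    - apply Hd. rewrite HE. simpl. split; [apply exp_pos|].
      rewrite <- (exp_ln rho) by lra. now apply exp_increasing. }
  destruct (Hc (delta / 2)) as [d [Pdd Hcd]]; [lra|].
  (* The first term makes the inner circle so small that the real part of [H] exceeds
     [fst (H c) - delta / 2] on it; the second ensures [s1 < s2]. *)
  set (s1 := Rmin (ln (d / 2)) (ln r - 1)). set (s2 := ln r).
  assert (S1 : s1 <= ln (d / 2)) by apply Rmin_l. assert (S2 : s1 <= ln r - 1) by apply Rmin_r.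
  assert (S3 : s2 < ln rho) by (apply ln_increasing; lra).
  pose proof PI_RGT_0 as Ppi.
  assert (E := vertical_integral_const _ _ _ HCR s1 s2 0 (2 * PI)
     ltac:(unfold s2; lra) S3 ltac:(lra)).
  assert (E' : RInt (fun t => fst (F (s1, t))) 0 (2 * PI) = RInt (fun t => fst (F (s2, t))) 0 (2 * PI)).
  { apply E. intros s. unfold F, cexp. simpl. now rewrite cos_2PI, sin_2PI, cos_0, sin_0. }
  assert (X : forall s, s < ln rho -> ex_RInt (fun t => fst (F (s, t))) 0 (2 * PI)).
  { intros s Hs. exact (ex_RInt_vert _ _ _ HCR s 0 (2 * PI) Hs). }
  assert (L : forall x : R, RInt (fun _ => x) 0 (2 * PI) = (2 * PI - 0) * x)
    by (intros x; exact (RInt_const 0 (2 * PI) x)).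
  assert (B1 : RInt (fun _ => fst (H c) - delta / 2) 0 (2 * PI) <= RInt (fun t => fst (F (s1, t))) 0 (2 * PI)).
  { apply RInt_le; [lra|apply ex_RInt_const|apply X; unfold s2 in *; lra|].
    intros t _. assert (N : Cnorm (c + cexp (s1, t) - c)%cx < d).
    { rewrite HE. simpl. apply Rle_lt_trans with (exp (ln (d / 2))).
      - destruct S1 as [S1|S1]; [left; now apply exp_increasing|right; now rewrite S1].
      - rewrite exp_ln; lra. }
    specialize (Hcd _ N). fold (F (s1, t)) in Hcd.
    pose proof (Cnorm_fst (F (s1, t) - H c)%cx) as N1. simpl in N1.
    apply Rabs_le_between in N1. lra. }
  assert (B2 : RInt (fun t => fst (F (s2, t))) 0 (2 * PI) <= RInt (fun _ => fst (H c) - delta) 0 (2 * PI)).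
  { apply RInt_le; [lra|now apply X|apply ex_RInt_const|].
    intros t _. apply Hbad. rewrite HE. simpl. unfold s2. rewrite exp_ln; lra. }
  rewrite L in B1, B2. nra.
Qed.

(** * The maximum modulus principle *)

(** Bisection runs on rectangles whose points in the ball are cofinal for [u]. If no quarter had
    this property, each would be strictly beaten by some point of the ball, and the best of these
    four points would beat every point of the rectangle. Near the limit point [u] then takes values
    at least as large as any prescribed one, and continuity does the rest. *)
Lemma closed_ball_max (u : Cx -> R) r : 0 < r ->
  (forall z, Cnorm z <= r -> forall e, 0 < e -> exists d, 0 < d /\
     forall w, Cnorm (w - z)%cx < d -> Rabs (u w - u z) < e) ->
  exists z, Cnorm z <= r /\ forall w, Cnorm w <= r -> u w <= u z.
Proof.
  intros Hr Hu.
  set (P := fun a b c d => forall x, Cnorm x <= r ->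
     exists y, Cnorm y <= r /\ a <= fst y <= b /\ c <= snd y <= d /\ u x <= u y).
  destruct (bisection_point P (- r) r (- r) r) as [s [t [Hs [Ht Hk]]]]; [lra|lra| | |].
  { intros x Hx. exists x. pose proof (Cnorm_fst x) as N1; pose proof (Cnorm_snd x) as N2.
    apply Rabs_le_between in N1, N2. repeat split; lra. }
  { intros a b c d Hab Hcd HP s t. apply NNPP; intros N.
    assert (Q : forall a b c d, ~ P a b c d -> exists x, Cnorm x <= r /\
       forall y, Cnorm y <= r -> a <= fst y <= b -> c <= snd y <= d -> u y < u x).
    { intros a' b' c' d' H. apply not_all_ex_not in H. destruct H as [x H].
      apply imply_to_and in H. destruct H as [Hx H]. exists x; split; [assumption|].
      intros y Hy H1 H2. apply Rnot_le_lt. intros H3. apply H. exists y; tauto. }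
    destruct (Q a s c t) as [x1 [N1 H1]]; [tauto|].
    destruct (Q a s t d) as [x2 [N2 H2]]; [tauto|].
    destruct (Q s b c t) as [x3 [N3 H3]]; [tauto|].
    destruct (Q s b t d) as [x4 [N4 H4]]; [tauto|].
    assert (M2 : forall x y, Cnorm x <= r -> Cnorm y <= r ->
       exists z, Cnorm z <= r /\ u x <= u z /\ u y <= u z).
    { intros x y Hx Hy. destruct (Rle_dec (u x) (u y)); [exists y|exists x]; repeat split; lra. }
    destruct (M2 x1 x2 N1 N2) as [z1 [Z1 [U1 U2]]].
    destruct (M2 x3 x4 N3 N4) as [z2 [Z2 [U3 U4]]].
    destruct (M2 z1 z2 Z1 Z2) as [z [Z [V1 V2]]].
    destruct (HP z Z) as [y [Hy [By1 [By2 Huy]]]].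
    destruct (Rle_dec (fst y) s) as [F|F]; destruct (Rle_dec (snd y) t) as [G|G].
    - specialize (H1 y Hy ltac:(lra) ltac:(lra)); lra.
    - specialize (H2 y Hy ltac:(lra) ltac:(lra)); lra.
    - specialize (H3 y Hy ltac:(lra) ltac:(lra)); lra.
    - specialize (H4 y Hy ltac:(lra) ltac:(lra)); lra. }
  assert (Near : forall d x, 0 < d -> Cnorm x <= r ->
     exists y, Cnorm y <= r /\ Cnorm (y - (s, t))%cx < d /\ u x <= u y).
  { intros d x Pd Hx. destruct (half_pow_small (r - - r) (d / 2)) as [k Hkd]; [lra|].
    destruct (Hk k) as [a [b [c [d' [HP [E1 [E2 [S1 S2]]]]]]]].
    destruct (HP x Hx) as [y [Hy [By1 [By2 Huy]]]]. exists y; repeat split; try assumption.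
    eapply Rle_lt_trans; [apply Cnorm_le_sum|]. simpl.
    assert (Rabs (fst y + - s) <= b - a) by (apply Rabs_le; lra).
    assert (Rabs (snd y + - t) <= d' - c) by (apply Rabs_le; lra). lra. }
  exists (s, t).
  assert (Hin : Cnorm (s, t) <= r).
  { apply Rnot_lt_le. intros N. destruct (Near (Cnorm (s, t) - r) C0) as [y [Hy [Hd _]]];
      [lra|rewrite Cnorm_C0; lra|].
    pose proof (Cnorm_sub_ge (s, t) y). rewrite Cnorm_sub_sym in Hd. lra. }
  split; [assumption|]. intros w Hw. apply Rnot_lt_le. intros N.
  destruct (Hu (s, t) Hin (u w - u (s, t))) as [d [Pd Hd]]; [lra|].
  destruct (Near d w Pd Hw) as [y [Hy [Hdy Hy']]]. specialize (Hd y Hdy).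
  apply Rabs_lt_between in Hd. lra.
Qed.

(** Expresses the inner product of the plane by moduli, so that a bound on moduli becomes a bound on
    the real part of a function holomorphic in [w], to which the mean value inequality applies. *)
Lemma Cnorm_polarization z w :
  2 * fst (Conj z * w)%cx = Cnorm z * Cnorm z + Cnorm w * Cnorm w - Cnorm (w - z)%cx * Cnorm (w - z)%cx.
Proof. rewrite !Cnorm_sqr. simpl. ring. Qed.

(* Maximise |f|^2 + eps |z|^2: at an interior maximum c, the real part of
   2 conj(f c) f + 2 eps conj(c) z would be strictly smaller on a circle around c than at c. *)
Lemma max_modulus f rad B : 0 < rad -> (forall z, Cnorm z <= rad -> cont_at f z) ->
  (forall c, Cnorm c < rad -> exists rho, 0 < rho /\
     forall w, 0 < Cnorm (w - c)%cx < rho -> cdiff f w) ->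
  (forall z, Cnorm z = rad -> Cnorm (f z) <= B) ->
  forall z, Cnorm z <= rad -> Cnorm (f z) <= B.
Proof.
  intros HR Hc Hd HB z0 Hz0. apply Rnot_lt_le. intros Hgt.
  assert (B0 : 0 <= B).
  { apply Rle_trans with (Cnorm (f (rad, 0))); [apply Cnorm_ge0|apply HB].
    apply Cnorm_unique; simpl; lra. }
  set (N := fun z => Cnorm (f z) * Cnorm (f z)).
  (* The perturbation uses up half of the assumed excess at [|z| = rad], so [u] on the boundary
     stays below [u z0] and the maximum is interior. *)
  set (eps := (N z0 - B * B) / (2 * (rad * rad))).
  assert (Hgt2 : 0 < N z0 - B * B) by (unfold N; nra).
  assert (Heps : 0 < eps) by (apply Rdiv_lt_0_compat; nra).
  assert (Heq : eps * (rad * rad) = (N z0 - B * B) / 2) by (unfold eps; field; lra).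
  set (u := fun z => N z + eps * (Cnorm z * Cnorm z)).
  assert (Hnc : forall g z, cont_at g z -> forall e, 0 < e -> exists d, 0 < d /\
     forall w, Cnorm (w - z)%cx < d ->
       Rabs (Cnorm (g w) * Cnorm (g w) - Cnorm (g z) * Cnorm (g z)) < e).
  { intros g z Hg e He.
    assert (Hg2 : cont_at (fun w => g w * Conj (g w))%cx z).
    { apply (cont_mul g); [assumption|]. intros e' He'. destruct (Hg e' He') as [d [P H]].
      exists d; split; [assumption|]. intros w Hw. eapply Rle_lt_trans; [|exact (H w Hw)].
      right. apply Cnorm_unique; [apply Cnorm_ge0|]. rewrite Cnorm_sqr. simpl. ring. }
    destruct (Hg2 e He) as [d [P H]]. exists d; split; [assumption|]. intros w Hw.
    eapply Rle_lt_trans; [|exact (H w Hw)]. eapply Rle_trans; [|apply Cnorm_fst].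
    rewrite !Cnorm_sqr. right; apply (f_equal Rabs); simpl; ring. }
  destruct (closed_ball_max u rad HR) as [c [Hcr Hmax]].
  { intros z Hz e He. destruct (Hnc f z (Hc z Hz) (e / 2)) as [d1 [P1 H1]]; [lra|].
    destruct (Hnc (fun w => w) z (cont_id z) (e / 2 / eps)) as [d2 [P2 H2]];
      [apply Rdiv_lt_0_compat; lra|].
    exists (Rmin d1 d2); split; [now apply Rmin_glb_lt|]. intros w Hw.
    pose proof (Rmin_l d1 d2); pose proof (Rmin_r d1 d2).
    specialize (H1 w ltac:(lra)). specialize (H2 w ltac:(lra)). cbv beta in H2. unfold u, N.
    replace (Cnorm (f w) * Cnorm (f w) + eps * (Cnorm w * Cnorm w) -
             (Cnorm (f z) * Cnorm (f z) + eps * (Cnorm z * Cnorm z)))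
      with ((Cnorm (f w) * Cnorm (f w) - Cnorm (f z) * Cnorm (f z))
            + eps * (Cnorm w * Cnorm w - Cnorm z * Cnorm z)) by ring.
    eapply Rle_lt_trans; [apply Rabs_triang|]. rewrite (Rabs_mult eps), (Rabs_pos_eq eps) by lra.
    apply Rmult_lt_compat_l with (r := eps) in H2; [|assumption].
    replace (eps * (e / 2 / eps)) with (e / 2) in H2 by (field; lra). lra. }
  destruct (Rle_lt_or_eq_dec _ _ Hcr) as [Hin|Hb].
  - destruct (Hd c Hin) as [rho [Pr Hdr]].
    set (r := Rmin (rho / 2) (rad - Cnorm c)).
    assert (Hr1 : r <= rho / 2) by apply Rmin_l. assert (Hr2 : r <= rad - Cnorm c) by apply Rmin_r.
    assert (Pr' : 0 < r) by (apply Rmin_glb_lt; lra).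
    set (H := fun w => (Conj (f c) * f w + Conj ((eps, 0) * c) * w)%cx).
    assert (FH : forall w, 2 * fst (H w) = 2 * fst (Conj (f c) * f w)%cx + eps * (2 * fst (Conj c * w)%cx)).
    { intros w. unfold H. simpl. ring. }
    assert (0 < eps * (r * r)) by (apply Rmult_lt_0_compat; [assumption|now apply Rmult_lt_0_compat]).
    (* By polarization, [2 * fst (H w)] is at most [u c + u w - eps * (r * r)] on the circle, while
       [2 * fst (H c) = 2 * u c]; since [u w <= u c], the drop is at least half of
       [eps * (r * r)]. *)
    apply (circle_mean_not_below H c rho r (eps * (r * r) / 2)); [lra| | |lra|].
    + unfold H. apply (cont_add (fun w => Conj (f c) * f w)%cx).
      * apply (cont_mul (fun _ => Conj (f c))); [apply cont_const|apply Hc; lra].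
      * apply (cont_mul (fun _ => Conj ((eps, 0) * c)%cx)); [apply cont_const|apply cont_id].
    + intros w Hw. unfold H. apply (cdiff_add (fun w => Conj (f c) * f w)%cx).
      * apply (cdiff_mul (fun _ => Conj (f c))); [apply cdiff_const|now apply Hdr].
      * apply (cdiff_mul (fun _ => Conj ((eps, 0) * c)%cx)); [apply cdiff_const|apply cdiff_id].
    + intros w Hw. pose proof (FH w) as F1; pose proof (FH c) as F2.
      rewrite !Cnorm_polarization, Hw in F1. rewrite !Cnorm_polarization, !Cnorm_sub_diag in F2.
      assert (Hwr : Cnorm w <= rad).
      { pose proof (Cnorm_sub_ge w c). lra. }
      pose proof (Hmax w Hwr) as Hu. unfold u, N in Hu.
      assert (0 <= Cnorm (f w - f c)%cx * Cnorm (f w - f c)%cx)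
        by (pose proof (Cnorm_ge0 (f w - f c)%cx); nra).
      lra.
  - specialize (HB c Hb). specialize (Hmax z0 Hz0). unfold u in Hmax. rewrite Hb in Hmax.
    assert (N c <= B * B) by (unfold N; pose proof (Cnorm_ge0 (f c)); nra).
    assert (0 <= eps * (Cnorm z0 * Cnorm z0)) by (pose proof (Cnorm_ge0 z0); apply Rmult_le_pos; nra).
    lra.
Qed.

(** * Functions on analytic images of the disk *)

Lemma normN_ge0 N P : 0 <= normN N P.
Proof. induction N; simpl; [lra|]. pose proof (Cnorm_ge0 (P N)); lra. Qed.

Lemma normN_sub_diag N P : normN N (ptsub P P) = 0.
Proof. unfold ptsub. induction N; simpl; [reflexivity|]. rewrite IHN, Cnorm_sub_diag; lra. Qed.

Lemma Csum_lin_bound N (L : nat -> Cx) :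
  exists K, 0 <= K /\ forall P, Cnorm (Csum N (fun i => L i * P i)%cx) <= K * normN N P.
Proof.
  induction N as [|N [K [HK H]]].
  - exists 0; split; [lra|]. intros P; simpl. rewrite Cnorm_C0; lra.
  - pose proof (Cnorm_ge0 (L N)) as HL. exists (K + Cnorm (L N)); split; [lra|].
    intros P; simpl. eapply Rle_trans; [apply Cnorm_triang|]. rewrite Cnorm_mul.
    specialize (H P). pose proof (Cnorm_ge0 (P N)); pose proof (normN_ge0 N P). nra.
Qed.

Lemma cderivN_lipschitz N F P L : is_cderivN N F P L ->
  exists K d, 0 < K /\ 0 < d /\ forall Q, inCN N Q -> normN N (ptsub Q P) < d ->
    Cnorm (F Q - F P)%cx <= K * normN N (ptsub Q P).
Proof.
  intros H. destruct (H 1) as [d [Pd Hd]]; [lra|].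
  destruct (Csum_lin_bound N L) as [K [HK HL]].
  exists (K + 1), d. repeat split; [lra|assumption|]. intros Q HQ HQd.
  specialize (Hd Q HQ HQd). specialize (HL (ptsub Q P)). unfold ptsub at 1 in HL.
  pose proof (Cnorm_sub_ge (F Q - F P)%cx (Csum N (fun i => L i * (Q i - P i))%cx)). lra.
Qed.

Lemma cderivN_coord N i P : (i < N)%nat ->
  is_cderivN N (fun Q => Q i) P (fun j => if Nat.eq_dec j i then C1 else C0).
Proof.
  intros Hi e He. exists 1; split; [lra|]. intros Q _ _.
  assert (E : Csum N (fun j => (if Nat.eq_dec j i then C1 else C0) * (Q j - P j))%cx = (Q i - P i)%cx).
  { rewrite (Csum_split N i) by lia. rewrite Csum_zero.
    - replace (N - i)%nat with (1 + (N - i - 1))%nat by lia.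
      rewrite (Csum_split (1 + (N - i - 1)) 1) by lia. rewrite (Csum_zero (1 + (N - i - 1) - 1)).
      + simpl. rewrite Nat.add_0_r. destruct (Nat.eq_dec i i); [ring|congruence].
      + intros k _. destruct Nat.eq_dec; [lia|ring].
    - intros k Hk. destruct Nat.eq_dec; [lia|ring]. }
  rewrite E, Cnorm_sub_diag. apply Rmult_le_pos; [lra|apply normN_ge0].
Qed.

Lemma cderivN_lincomb N P (L : nat -> Cx) (Phi : pt -> pt) (M : nat -> nat -> Cx) k :
  (forall j, (j < k)%nat -> is_cderivN N (fun Q => Phi Q j) P (M j)) ->
  is_cderivN N (fun Q => Csum k (fun j => L j * Phi Q j)%cx) P
    (fun i => Csum k (fun j => L j * M j i)%cx).
Proof.
  induction k as [|k IH]; intros H e He.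
  - exists 1; split; [lra|]. intros Q _ _. simpl.
    rewrite Csum_zero by (intros; ring). rewrite !Csub_diag, Cnorm_C0.
    apply Rmult_le_pos; [lra|apply normN_ge0].
  - specialize (IH ltac:(auto)). pose proof (Cnorm_ge0 (L k)) as HL.
    destruct (IH (e / 2)) as [d1 [P1 H1]]; [lra|].
    assert (He' : 0 < e / 2 / (Cnorm (L k) + 1)) by (apply Rdiv_lt_0_compat; lra).
    destruct (H k (Nat.lt_succ_diag_r k) _ He') as [d2 [P2 H2]].
    exists (Rmin d1 d2); split; [now apply Rmin_glb_lt|]. intros Q HQ Hd.
    pose proof (Rmin_l d1 d2); pose proof (Rmin_r d1 d2).
    specialize (H1 Q HQ ltac:(lra)). specialize (H2 Q HQ ltac:(lra)). simpl.
    set (n := normN N (ptsub Q P)) in *.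
    match type of H1 with Cnorm ?a <= _ => set (A := a) in * end.
    match type of H2 with Cnorm ?a <= _ => set (B := a) in * end.
    match goal with |- Cnorm ?a <= _ => replace a with (A + L k * B)%cx end.
    + eapply Rle_trans; [apply Cnorm_triang|]. rewrite Cnorm_mul.
      assert (HX : Cnorm (L k) * Cnorm B <= (Cnorm (L k) + 1) * (e / 2 / (Cnorm (L k) + 1) * n)).
      { apply Rmult_le_compat; try lra. apply Cnorm_ge0. }
      replace ((Cnorm (L k) + 1) * (e / 2 / (Cnorm (L k) + 1) * n)) with (e / 2 * n) in HX
        by (field; lra). lra.
    + unfold A, B.
      rewrite (Csum_ext N (fun i => (Csum k (fun j => L j * M j i) + L k * M k i) * (Q i - P i))%cx
         (fun i => (Csum k (fun j => L j * M j i) * (Q i - P i)) + L k * (M k i * (Q i - P i)))%cx)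
        by (intros; ring).
      rewrite Csum_add, Csum_scal. ring.
Qed.

(** [Phi] has to take values in C^N2 because [is_cderivN] tests [G] only at such points. The error
    splits into that of [G], controlled by a local Lipschitz bound for [Phi], and the linear form
    [L] applied to the errors of the coordinates. *)
Lemma cderivN_comp N1 N2 P (Phi : pt -> pt) G (M : nat -> nat -> Cx) L :
  (forall Q, inCN N2 (Phi Q)) ->
  (forall j, (j < N2)%nat -> is_cderivN N1 (fun Q => Phi Q j) P (M j)) ->
  is_cderivN N2 G (Phi P) L ->
  is_cderivN N1 (fun Q => G (Phi Q)) P (fun i => Csum N2 (fun j => L j * M j i)%cx).
Proof.
  intros Hin HM HG.
  assert (Lip : exists K d, 0 < K /\ 0 < d /\ forall Q, inCN N1 Q -> normN N1 (ptsub Q P) < d ->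
     normN N2 (ptsub (Phi Q) (Phi P)) <= K * normN N1 (ptsub Q P)).
  { clear HG Hin. induction N2 as [|k IH].
    - exists 1, 1. repeat split; try lra. intros; simpl. rewrite Rmult_1_l. apply normN_ge0.
    - destruct IH as [K1 [d1 [PK1 [Pd1 H1]]]]; [auto|].
      destruct (cderivN_lipschitz _ _ _ _ (HM k (Nat.lt_succ_diag_r k))) as [K2 [d2 [PK2 [Pd2 H2]]]].
      exists (K1 + K2), (Rmin d1 d2). repeat split; [lra|now apply Rmin_glb_lt|].
      intros Q HQ Hd. pose proof (Rmin_l d1 d2); pose proof (Rmin_r d1 d2).
      specialize (H1 Q HQ ltac:(lra)). specialize (H2 Q HQ ltac:(lra)). simpl.
      unfold ptsub at 2. lra. }
  destruct Lip as [K [d0 [PK [Pd0 HK]]]].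
  intros e He. pose proof (cderivN_lincomb N1 P L Phi M N2 HM) as HL.
  destruct (HL (e / 2)) as [d1 [P1 H1]]; [lra|].
  destruct (HG (e / 2 / K)) as [d2 [P2 H2]]; [apply Rdiv_lt_0_compat; lra|].
  assert (P2' : 0 < d2 / K) by (apply Rdiv_lt_0_compat; lra).
  exists (Rmin d0 (Rmin d1 (d2 / K))); split; [repeat apply Rmin_glb_lt; assumption|].
  intros Q HQ Hd.
  pose proof (Rmin_l d0 (Rmin d1 (d2 / K))); pose proof (Rmin_r d0 (Rmin d1 (d2 / K))).
  pose proof (Rmin_l d1 (d2 / K)); pose proof (Rmin_r d1 (d2 / K)).
  specialize (HK Q HQ ltac:(lra)). specialize (H1 Q HQ ltac:(lra)).
  specialize (H2 (Phi Q) (Hin Q)).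
  assert (Hlt : normN N2 (ptsub (Phi Q) (Phi P)) < d2).
  { eapply Rle_lt_trans; [exact HK|]. apply Rlt_le_trans with (K * (d2 / K)).
    - apply Rmult_lt_compat_l; lra.
    - right; field; lra. }
  specialize (H2 Hlt). set (n := normN N1 (ptsub Q P)) in *.
  match type of H1 with Cnorm ?a <= _ => set (A := a) in * end.
  match type of H2 with Cnorm ?a <= _ => set (B := a) in * end.
  match goal with |- Cnorm ?a <= _ => replace a with (B + A)%cx end.
  - eapply Rle_trans; [apply Cnorm_triang|].
    assert (HX : e / 2 / K * normN N2 (ptsub (Phi Q) (Phi P)) <= e / 2 / K * (K * n)).
    { apply Rmult_le_compat_l; [|assumption]. left. apply Rdiv_lt_0_compat; lra. }
    replace (e / 2 / K * (K * n)) with (e / 2 * n) in HX by (field; lra). lra.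
  - unfold A, B.
    rewrite (Csum_ext N2 (fun i => L i * (Phi Q i - Phi P i))%cx
       (fun i => L i * Phi Q i + (- C1) * (L i * Phi P i))%cx) by (intros; ring).
    rewrite Csum_add, Csum_scal. ring.
Qed.

Lemma OV_coord N V i : (i < N)%nat -> OV N V (fun Q => Q i).
Proof.
  intros Hi P _. exists 1, (fun Q => Q i). repeat split; [lra|].
  intros Q _ _. eexists. now apply cderivN_coord.
Qed.

Lemma OV_ext N V F G : (forall P, V P -> F P = G P) -> OV N V F -> OV N V G.
Proof.
  intros E H P HP. destruct (H P HP) as [r [K [Pr [HK HF]]]].
  exists r, K. repeat split; try assumption. intros Q HQ Hd. rewrite <- E by assumption. auto.
Qed.

Lemma OV_continuous N V F P : (forall P, V P -> inCN N P) -> OV N V F -> V P ->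
  forall eps, 0 < eps -> exists delta, 0 < delta /\
    forall Q, V Q -> normN N (ptsub Q P) < delta -> Cnorm (F Q - F P)%cx < eps.
Proof.
  intros HV HF HP e He. destruct (HF P HP) as [r [G [Pr [HG E]]]].
  destruct (HG P (HV P HP)) as [L HL]; [rewrite normN_sub_diag; lra|].
  destruct (cderivN_lipschitz _ _ _ _ HL) as [K [d [PK [Pd Hd]]]].
  assert (0 < e / K) by (apply Rdiv_lt_0_compat; lra).
  exists (Rmin r (Rmin d (e / K))); split; [repeat apply Rmin_glb_lt; assumption|].
  intros Q HQ HQd.
  pose proof (Rmin_l r (Rmin d (e / K))); pose proof (Rmin_r r (Rmin d (e / K))).
  pose proof (Rmin_l d (e / K)); pose proof (Rmin_r d (e / K)).
  rewrite (E Q), (E P) by (try rewrite normN_sub_diag; assumption || lra).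
  eapply Rle_lt_trans; [apply Hd; [auto|lra]|].
  apply Rlt_le_trans with (K * (e / K)); [apply Rmult_lt_compat_l; lra|right; field; lra].
Qed.

(** Membership in O(V) extends each coordinate on a ball of its own radius. Induction on the number
    of coordinates yields a common radius, and padding with zeros keeps the joint extension in
    C^k. *)
Lemma OV_local_lift N1 k V phi P : V P ->
  (forall i, (i < k)%nat -> OV N1 V (fun Q => phi Q i)) ->
  exists r Phi, 0 < r /\ (forall Q, inCN k (Phi Q)) /\
    (forall i, (i < k)%nat -> holo_ball N1 (fun Q => Phi Q i) P r) /\
    (forall Q, V Q -> normN N1 (ptsub Q P) < r -> forall i, (i < k)%nat -> phi Q i = Phi Q i).
Proof.
  intros HP. induction k as [|k IH]; intros H.
  - exists 1, (fun _ _ => C0). repeat split; try lra; intros; lia.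
  - destruct IH as [r1 [Phi [P1 [Hin [H1 E1]]]]]; [auto|].
    destruct (H k (Nat.lt_succ_diag_r k) P HP) as [r2 [G [P2 [H2 E2]]]].
    exists (Rmin r1 r2), (fun Q i => if Nat.eq_dec i k then G Q else Phi Q i).
    pose proof (Rmin_l r1 r2); pose proof (Rmin_r r1 r2).
    repeat split.
    + now apply Rmin_glb_lt.
    + intros Q i Hi. destruct Nat.eq_dec; [lia|]. apply Hin; lia.
    + intros i Hi Q HQ Hd. destruct (Nat.eq_dec i k); [apply H2; [assumption|lra]|].
      apply (H1 i); [lia|assumption|lra].
    + intros Q HQ Hd i Hi. destruct (Nat.eq_dec i k) as [->|]; [apply E2; [assumption|lra]|].
      apply E1; [assumption|lra|lia].
Qed.

(** The ambient extensions are composed. Off [V1] the extension [Phi] may leave [V2]; what matters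
    is that near [P] it stays, by continuity, in the ball on which [G] is holomorphic. *)
Lemma OV_comp N1 N2 V1 V2 phi F :
  (forall P, V1 P -> inCN N1 P) -> (forall P, V2 P -> inCN N2 P) ->
  (forall P, V1 P -> V2 (phi P)) ->
  (forall i, (i < N2)%nat -> OV N1 V1 (fun P => phi P i)) ->
  OV N2 V2 F -> OV N1 V1 (fun P => F (phi P)).
Proof.
  intros HV1 HV2 Hphi Hc HF P HP.
  destruct (OV_local_lift N1 N2 V1 phi P HP Hc) as [r1 [Phi [P1 [Hin [H1 E1]]]]].
  destruct (HF (phi P) (Hphi P HP)) as [r2 [G [P2 [H2 E2]]]].
  assert (Heq : forall Q, V1 Q -> normN N1 (ptsub Q P) < r1 -> phi Q = Phi Q).
  { intros Q HQ Hd. apply functional_extensionality; intros i.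
    destruct (Nat.lt_ge_cases i N2) as [Hi|Hi]; [now apply E1|].
    rewrite (HV2 _ (Hphi Q HQ)), Hin by assumption. reflexivity. }
  assert (HPP : normN N1 (ptsub P P) < r1) by (rewrite normN_sub_diag; assumption).
  assert (Cont : exists d, 0 < d /\ forall Q, inCN N1 Q -> normN N1 (ptsub Q P) < d ->
     normN N2 (ptsub (Phi Q) (Phi P)) < r2).
  { assert (Hk : forall k, (k <= N2)%nat -> forall e, 0 < e -> exists d, 0 < d /\
       forall Q, inCN N1 Q -> normN N1 (ptsub Q P) < d -> normN k (ptsub (Phi Q) (Phi P)) < e).
    { induction k as [|k IH]; intros Hle e He.
      - exists 1; split; [lra|]. intros; simpl; lra.
      - destruct (IH ltac:(lia) (e / 2)) as [d1 [Pd1 Hd1]]; [lra|].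
        destruct (H1 k ltac:(lia) P (HV1 P HP) HPP) as [L HL].
        destruct (cderivN_lipschitz _ _ _ _ HL) as [K [d [PK [Pd Hd]]]].
        assert (0 < e / 2 / K) by (apply Rdiv_lt_0_compat; lra).
        exists (Rmin d1 (Rmin d (e / 2 / K))); split; [repeat apply Rmin_glb_lt; assumption|].
        intros Q HQ HQd.
        pose proof (Rmin_l d1 (Rmin d (e / 2 / K))); pose proof (Rmin_r d1 (Rmin d (e / 2 / K))).
        pose proof (Rmin_l d (e / 2 / K)); pose proof (Rmin_r d (e / 2 / K)).
        specialize (Hd1 Q HQ ltac:(lra)). specialize (Hd Q HQ ltac:(lra)). simpl.
        unfold ptsub at 2.
        assert (HX : K * normN N1 (ptsub Q P) < K * (e / 2 / K)) by (apply Rmult_lt_compat_l; lra).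
        replace (K * (e / 2 / K)) with (e / 2) in HX by (field; lra). lra. }
    exact (Hk N2 (Nat.le_refl _) r2 P2). }
  destruct Cont as [d [Pd Hd]].
  exists (Rmin r1 d), (fun Q => G (Phi Q)).
  pose proof (Rmin_l r1 d); pose proof (Rmin_r r1 d).
  repeat split; [now apply Rmin_glb_lt| |].
  - intros Q HQ HQd.
    destruct (H2 (Phi Q) (Hin Q)) as [L HL].
    { rewrite (Heq P HP HPP). apply Hd; [assumption|lra]. }
    assert (HM : exists M : nat -> nat -> Cx, forall j, (j < N2)%nat ->
       is_cderivN N1 (fun Q => Phi Q j) Q (M j)).
    { exists (fun j => epsilon (inhabits (fun _ => C0)) (fun L => is_cderivN N1 (fun Q => Phi Q j) Q L)).
      intros j Hj. apply epsilon_spec. apply (H1 j Hj Q HQ). lra. }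
    destruct HM as [M HM]. eexists. eapply cderivN_comp; eassumption.
  - intros Q HQ HQd. rewrite E2.
    + rewrite (Heq Q HQ) by lra. reflexivity.
    + now apply Hphi.
    + rewrite (Heq Q HQ), (Heq P HP) by lra. apply Hd; [auto|lra].
Qed.

(** * Biholomorphisms as bijections of the disk *)

(* Pullback along theta and psi exchanges the two algebras, so theta is the disk-level form of a
   biholomorphism between the images. *)
Definition algebra_equiv (A B : (Cx -> Cx) -> Prop) (theta psi : Cx -> Cx) : Prop :=
  (forall z, Disk z -> Disk (theta z)) /\ (forall w, Disk w -> Disk (psi w)) /\
  (forall z, Disk z -> psi (theta z) = z) /\ (forall w, Disk w -> theta (psi w) = w) /\
  (forall f, B f -> A (fun z => f (theta z))) /\ (forall f, A f -> B (fun w => f (psi w))).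

Lemma algebra_equiv_sym A B theta psi :
  algebra_equiv A B theta psi -> algebra_equiv B A psi theta.
Proof. unfold algebra_equiv; tauto. Qed.

Definition separates_disk (A : (Cx -> Cx) -> Prop) : Prop :=
  forall z w, Disk z -> Disk w -> (forall f, A f -> f z = f w) -> z = w.

(** A holomap is one-to-one only off a finite set. On the remaining points injectivity comes from
    the algebra, whose members factor through [h] and yet separate points. *)
Lemma holization_inj (N : nat) (h : Cx -> pt) (D : (Cx -> Cx) -> Prop) :
  holizes N h D -> separates_disk D -> forall z w, Disk z -> Disk w -> h z = h w -> z = w.
Proof.
  intros HD SD z w Hz Hw E. apply SD; [assumption|assumption|]. intros f Hf.
  apply HD in Hf. destruct Hf as [F [_ HF]]. now rewrite !HF, E.
Qed.

Section Transfer.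

Variables (A B : (Cx -> Cx) -> Prop) (Na Nb : nat) (ha hb : Cx -> pt).
Hypothesis Hina : forall z, Disk z -> inCN Na (ha z).
Hypothesis Hinb : forall z, Disk z -> inCN Nb (hb z).
Hypothesis HA : holizes Na ha A.
Hypothesis HB : holizes Nb hb B.
Hypothesis SA : separates_disk A.
Hypothesis SB : separates_disk B.

Lemma algebra_equiv_of_biholo phi :
  biholo_homeo Na Nb (image_disk ha) (image_disk hb) phi ->
  exists theta psi, algebra_equiv A B theta psi.
Proof.
  intros [psi [Hphi [Hpsi [Hpp [Hpp' [_ [_ [Oph Ops]]]]]]]].
  set (theta := fun z => epsilon (inhabits C0) (fun w => Disk w /\ hb w = phi (ha z))).
  set (eta := fun w => epsilon (inhabits C0) (fun z => Disk z /\ ha z = psi (hb w))).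
  assert (Ht : forall z, Disk z -> Disk (theta z) /\ hb (theta z) = phi (ha z)).
  { intros z Hz. apply (epsilon_spec (inhabits C0) (fun w => Disk w /\ hb w = phi (ha z))).
    apply Hphi. now exists z. }
  assert (He : forall w, Disk w -> Disk (eta w) /\ ha (eta w) = psi (hb w)).
  { intros w Hw. apply (epsilon_spec (inhabits C0) (fun z => Disk z /\ ha z = psi (hb w))).
    apply Hpsi. now exists w. }
  assert (Va : forall P, image_disk ha P -> inCN Na P) by (intros P [z [Hz <-]]; auto).
  assert (Vb : forall P, image_disk hb P -> inCN Nb P) by (intros P [z [Hz <-]]; auto).
  assert (Ia : forall z, Disk z -> image_disk ha (ha z)) by (intros z Hz; now exists z).
  assert (Ib : forall z, Disk z -> image_disk hb (hb z)) by (intros z Hz; now exists z).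
  exists theta, eta. repeat split.
  - intros z Hz. now apply Ht.
  - intros w Hw. now apply He.
  - intros z Hz. destruct (Ht z Hz) as [D1 E1]. destruct (He _ D1) as [D2 E2].
    apply (holization_inj Na ha A); try assumption. rewrite E2, E1. auto.
  - intros w Hw. destruct (He w Hw) as [D1 E1]. destruct (Ht _ D1) as [D2 E2].
    apply (holization_inj Nb hb B); try assumption. rewrite E2, E1. auto.
  - intros f Hf. apply HB in Hf. destruct Hf as [F [OF HF]]. apply HA.
    exists (fun P => F (phi P)). split.
    + apply (OV_comp Na Nb _ (image_disk hb)); assumption.
    + intros z Hz. destruct (Ht z Hz) as [D1 E1]. now rewrite HF, E1.
  - intros f Hf. apply HA in Hf. destruct Hf as [F [OF HF]]. apply HB.
    exists (fun P => F (psi P)). split.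
    + apply (OV_comp Nb Na _ (image_disk ha)); assumption.
    + intros z Hz. destruct (He z Hz) as [D1 E1]. now rewrite HF, E1.
Qed.

End Transfer.

(** * From an equivalence of algebras to a biholomorphism *)

Definition disk_inverse (h : Cx -> pt) (P : pt) : Cx :=
  epsilon (inhabits C0) (fun z => Disk z /\ h z = P).

Lemma disk_inverse_spec h P : image_disk h P -> Disk (disk_inverse h P) /\ h (disk_inverse h P) = P.
Proof. apply (epsilon_spec (inhabits C0) (fun z => Disk z /\ h z = P)). Qed.

Lemma disk_inverse_l N h A z : holizes N h A -> separates_disk A -> Disk z -> disk_inverse h (h z) = z.
Proof.
  intros HA SA Hz. destruct (disk_inverse_spec h (h z)) as [D E]; [now exists z|].
  now apply (holization_inj N h A).
Qed.

(** The coordinates of [hb] are themselves elements of [B]. Their pullbacks lie in [A], and elements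
    of [A] descend to O(V). *)
Lemma transport_coord_OV A B Na Nb ha hb theta :
  holizes Na ha A -> holizes Nb hb B -> separates_disk A ->
  (forall z, Disk z -> Disk (theta z)) -> (forall f, B f -> A (fun z => f (theta z))) ->
  forall i, (i < Nb)%nat -> OV Na (image_disk ha) (fun P => hb (theta (disk_inverse ha P)) i).
Proof.
  intros HA HB SA Ht Hpull i Hi.
  assert (Hf : B (fun w => hb w i)).
  { apply HB. exists (fun Q => Q i). split; [now apply OV_coord|reflexivity]. }
  apply Hpull, HA in Hf. destruct Hf as [F [OF EF]]. revert OF. apply OV_ext.
  intros P [z [Hz <-]]. rewrite <- EF by assumption.
  now rewrite (disk_inverse_l Na ha A).
Qed.

Lemma OV_coords_contV N1 N2 V phi : (forall P, V P -> inCN N1 P) ->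
  (forall i, (i < N2)%nat -> OV N1 V (fun P => phi P i)) -> contV N1 N2 V phi.
Proof.
  intros HV H P HP. induction N2 as [|k IH]; intros e He.
  - exists 1; split; [lra|]. intros; simpl; lra.
  - destruct (IH ltac:(auto) (e / 2)) as [d1 [P1 H1]]; [lra|].
    destruct (OV_continuous N1 V _ P HV (H k (Nat.lt_succ_diag_r k)) HP (e / 2)) as [d2 [P2 H2]]; [lra|].
    exists (Rmin d1 d2); split; [now apply Rmin_glb_lt|]. intros Q HQ Hd.
    pose proof (Rmin_l d1 d2); pose proof (Rmin_r d1 d2).
    specialize (H1 Q HQ ltac:(lra)). specialize (H2 Q HQ ltac:(lra)). simpl.
    unfold ptsub at 2. lra.
Qed.

Lemma biholo_of_algebra_equiv A B Na Nb ha hb theta psi :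
  (forall z, Disk z -> inCN Na (ha z)) -> (forall z, Disk z -> inCN Nb (hb z)) ->
  holizes Na ha A -> holizes Nb hb B -> separates_disk A -> separates_disk B ->
  algebra_equiv A B theta psi ->
  exists phi, biholo_homeo Na Nb (image_disk ha) (image_disk hb) phi.
Proof.
  intros Hina Hinb HA HB SA SB [Ht [Hp [Etp [Ept [Pt Pp]]]]].
  exists (fun P => hb (theta (disk_inverse ha P))), (fun Q => ha (psi (disk_inverse hb Q))).
  assert (Oa := transport_coord_OV A B Na Nb ha hb theta HA HB SA Ht Pt).
  assert (Ob := transport_coord_OV B A Nb Na hb ha psi HB HA SB Hp Pp).
  repeat split; try assumption.
  - intros P [z [Hz <-]]. rewrite (disk_inverse_l Na ha A) by assumption.
    exists (theta z); auto.
  - intros P [z [Hz <-]]. rewrite (disk_inverse_l Nb hb B) by assumption.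
    exists (psi z); auto.
  - intros P [z [Hz <-]]. rewrite (disk_inverse_l Na ha A), (disk_inverse_l Nb hb B) by auto.
    now rewrite Etp.
  - intros P [z [Hz <-]]. rewrite (disk_inverse_l Nb hb B), (disk_inverse_l Na ha A) by auto.
    now rewrite Ept.
  - apply OV_coords_contV; [intros P [z [Hz <-]]; auto|assumption].
  - apply OV_coords_contV; [intros P [z [Hz <-]]; auto|assumption].
Qed.

(** * Order of vanishing at the origin *)

(** Order of vanishing at 0 as a growth rate, so that it applies to [theta] before anything is known
    about its differentiability at 0. *)
Definition bigO (f : Cx -> Cx) (k : nat) : Prop :=
  exists C d, 0 <= C /\ 0 < d /\ forall z, Cnorm z < d -> Cnorm (f z) <= C * Cnorm z ^ k.

Lemma bigO_ext_loc f g k r : 0 < r -> (forall z, Cnorm z < r -> f z = g z) -> bigO f k -> bigO g k.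
Proof.
  intros Hr E [C [d [HC [Hd H]]]]. exists C, (Rmin d r). repeat split; [assumption|now apply Rmin_glb_lt|].
  intros z Hz. pose proof (Rmin_l d r); pose proof (Rmin_r d r). rewrite <- E by lra. apply H; lra.
Qed.

Lemma bigO_ext f g k : (forall z, f z = g z) -> bigO f k -> bigO g k.
Proof. intros E. apply (bigO_ext_loc f g k 1); [lra|auto]. Qed.

Lemma bigO_add f g k : bigO f k -> bigO g k -> bigO (fun z => f z + g z)%cx k.
Proof.
  intros [C1 [d1 [HC1 [Hd1 H1]]]] [C2 [d2 [HC2 [Hd2 H2]]]].
  exists (C1 + C2), (Rmin d1 d2). repeat split; [lra|now apply Rmin_glb_lt|].
  intros z Hz. pose proof (Rmin_l d1 d2); pose proof (Rmin_r d1 d2).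
  specialize (H1 z ltac:(lra)). specialize (H2 z ltac:(lra)).
  pose proof (Cnorm_triang (f z) (g z)). lra.
Qed.

Lemma bigO_mul f g k l : bigO f k -> bigO g l -> bigO (fun z => f z * g z)%cx (k + l).
Proof.
  intros [C1 [d1 [HC1 [Hd1 H1]]]] [C2 [d2 [HC2 [Hd2 H2]]]].
  exists (C1 * C2), (Rmin d1 d2). repeat split; [nra|now apply Rmin_glb_lt|].
  intros z Hz. pose proof (Rmin_l d1 d2); pose proof (Rmin_r d1 d2).
  specialize (H1 z ltac:(lra)). specialize (H2 z ltac:(lra)).
  rewrite Cnorm_mul, pow_add.
  replace (C1 * C2 * (Cnorm z ^ k * Cnorm z ^ l)) with ((C1 * Cnorm z ^ k) * (C2 * Cnorm z ^ l)) by ring.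
  apply Rmult_le_compat; try assumption; apply Cnorm_ge0.
Qed.

Lemma bigO_weaken f k l : (k <= l)%nat -> bigO f l -> bigO f k.
Proof.
  intros Hkl [C [d [HC [Hd H]]]]. exists C, (Rmin d 1). repeat split; [assumption|apply Rmin_glb_lt; lra|].
  intros z Hz. pose proof (Rmin_l d 1); pose proof (Rmin_r d 1).
  eapply Rle_trans; [apply H; lra|]. apply Rmult_le_compat_l; [assumption|].
  replace l with (k + (l - k))%nat by lia. rewrite pow_add.
  pose proof (Cnorm_ge0 z). pose proof (pow_le (Cnorm z) k H2).
  assert (Cnorm z ^ (l - k) <= 1) by (rewrite <- (pow1 (l - k)); apply pow_incr; lra).
  nra.
Qed.

Lemma bigO_pow_id k : bigO (fun z => z ^ k)%cx k.
Proof. exists 1, 1. repeat split; try lra. intros z _. rewrite Cnorm_pow; lra. Qed.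

Lemma bigO_cont f : cont_at f C0 -> bigO f 0.
Proof.
  intros H. destruct (cont_bounded f C0 H) as [d [P Hd]].
  exists (Cnorm (f C0) + 1), d. pose proof (Cnorm_ge0 (f C0)). repeat split; [lra|assumption|].
  intros z Hz. simpl. rewrite Rmult_1_r. left. apply Hd.
  replace (z - C0)%cx with z by ring. assumption.
Qed.

Lemma bigO_scal a f k : bigO f k -> bigO (fun z => a * f z)%cx k.
Proof. intros H. apply (bigO_mul (fun _ => a) f 0 k); [apply bigO_cont, cont_const|assumption]. Qed.

Lemma bigO_sub f g k : bigO f k -> bigO g k -> bigO (fun z => f z - g z)%cx k.
Proof.
  intros Hf Hg. apply (bigO_ext (fun z => f z + (- C1) * g z)%cx); [intros; ring|].
  apply bigO_add; [assumption|now apply bigO_scal].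
Qed.

Lemma bigO_csum n (f : nat -> Cx -> Cx) k : (forall j, (j < n)%nat -> bigO (f j) k) ->
  bigO (fun z => Csum n (fun j => f j z)) k.
Proof.
  induction n; simpl; intros H.
  - exists 0, 1. repeat split; try lra. intros. rewrite Cnorm_C0; lra.
  - apply (bigO_add (fun z => Csum n (fun j => f j z))); auto.
Qed.

Lemma bigO_pow f k j : bigO f k -> bigO (fun z => f z ^ j)%cx (j * k).
Proof.
  intros H; induction j; simpl; [apply bigO_cont, cont_const|].
  now apply (bigO_mul f (fun z => f z ^ j)%cx).
Qed.

Lemma bigO_at_0 f k : bigO f (S k) -> f C0 = C0.
Proof.
  intros [C [d [HC [Hd H]]]]. apply Cnorm_eq0. specialize (H C0). rewrite Cnorm_C0 in H.
  specialize (H Hd). rewrite pow_i in H by lia. pose proof (Cnorm_ge0 (f C0)). lra.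
Qed.

Lemma small_point d : 0 < d -> exists z, z <> C0 /\ Cnorm z < d.
Proof.
  intros Hd. assert (E : Cnorm (d / 2, 0) = d / 2) by (apply Cnorm_unique; simpl; lra).
  exists (d / 2, 0). split; [apply Cnorm_pos_neq0|]; lra.
Qed.

Lemma bigO_monomial a k : bigO (fun z => a * z ^ k)%cx (S k) -> a = C0.
Proof.
  intros [C [d [HC [Hd H]]]]. apply NNPP; intros Ha. pose proof (Cnorm_pos a Ha) as Pa.
  assert (Pq : 0 < Cnorm a / (C + 1)) by (apply Rdiv_lt_0_compat; lra).
  destruct (small_point (Rmin d (Cnorm a / (C + 1)))) as [z [Hz Hzd]]; [now apply Rmin_glb_lt|].
  pose proof (Rmin_l d (Cnorm a / (C + 1))); pose proof (Rmin_r d (Cnorm a / (C + 1))).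
  specialize (H z ltac:(lra)). rewrite Cnorm_mul, Cnorm_pow in H. simpl in H.
  pose proof (Cnorm_pos z Hz) as Pz. pose proof (pow_lt _ k Pz) as Pk.
  assert (Cnorm a <= C * Cnorm z).
  { apply Rmult_le_reg_r with (Cnorm z ^ k); [assumption|]. lra. }
  assert (Cnorm z * (C + 1) < Cnorm a).
  { apply Rlt_le_trans with (Cnorm a / (C + 1) * (C + 1)); [apply Rmult_lt_compat_r; lra|right; field; lra]. }
  nra.
Qed.

(** * The simple cusp algebras *)

Definition cusp_tail (n : nat) (alpha : nat -> Cx) (z : Cx) : Cx :=
  Csum n (fun k => alpha (S k) * z ^ (2 * k))%cx.

Lemma pi_alpha_factor n alpha z :
  pi_alpha n alpha z = (z ^ 2 + z ^ 3 * cusp_tail n alpha z)%cx.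
Proof.
  unfold pi_alpha, cusp_tail. f_equal. rewrite <- Csum_scal. apply Csum_ext. intros k _.
  replace (2 * S k + 1)%nat with (3 + 2 * k)%nat by lia. rewrite Cpow_add. ring.
Qed.

Lemma cdiff_pi_alpha n alpha z : cdiff (pi_alpha n alpha) z.
Proof.
  unfold pi_alpha. apply (cdiff_add (fun z => z ^ 2)%cx); [apply (cdiff_pow (fun z => z)), cdiff_id|].
  apply (cdiff_csum n (fun k z => alpha (S k) * z ^ (2 * S k + 1))%cx). intros k.
  apply (cdiff_mul (fun _ => alpha (S k))); [apply cdiff_const|apply (cdiff_pow (fun z => z)), cdiff_id].
Qed.

Lemma pi_alpha_C0 n alpha : pi_alpha n alpha C0 = C0.
Proof. rewrite pi_alpha_factor. ring. Qed.

Lemma bigO_pi_sub n alpha : bigO (fun z => pi_alpha n alpha z - z ^ 2)%cx 3.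
Proof.
  apply (bigO_ext (fun z => z ^ 3 * cusp_tail n alpha z)%cx).
  { intros z. rewrite pi_alpha_factor. ring. }
  apply (bigO_mul (fun z => z ^ 3)%cx _ 3 0); [apply bigO_pow_id|]. apply bigO_cont.
  unfold cusp_tail. apply (cont_csum n (fun k z => alpha (S k) * z ^ (2 * k))%cx). intros k.
  apply (cont_mul (fun _ => alpha (S k))); [apply cont_const|apply (cont_pow (fun z => z)), cont_id].
Qed.

Lemma bigO_pi n alpha : bigO (pi_alpha n alpha) 2.
Proof.
  apply (bigO_ext (fun z => z ^ 2 + (pi_alpha n alpha z - z ^ 2))%cx); [intros; ring|].
  apply (bigO_add (fun z => z ^ 2)%cx); [apply bigO_pow_id|].
  apply bigO_weaken with 3%nat; [lia|apply bigO_pi_sub].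
Qed.

Lemma bigO_pi_pow_sub n alpha k :
  bigO (fun z => pi_alpha n alpha z ^ k - z ^ (2 * k))%cx (2 * k + 1).
Proof.
  induction k as [|k IH].
  - apply (bigO_ext (fun z => C0 * z ^ 1)%cx); [intros; simpl; ring|].
    apply bigO_scal, bigO_pow_id.
  - apply (bigO_ext (fun z => pi_alpha n alpha z * (pi_alpha n alpha z ^ k - z ^ (2 * k))
              + z ^ (2 * k) * (pi_alpha n alpha z - z ^ 2))%cx).
    { intros z. replace (2 * S k)%nat with (2 * k + 2)%nat by lia. rewrite (Cpow_add z (2 * k)).
      change (pi_alpha n alpha z ^ S k)%cx with (pi_alpha n alpha z * pi_alpha n alpha z ^ k)%cx. ring. }
    replace (2 * S k + 1)%nat with (2 + (2 * k + 1))%nat by lia. apply bigO_add.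
    + apply (bigO_mul (pi_alpha n alpha)); [apply bigO_pi|exact IH].
    + replace (2 + (2 * k + 1))%nat with (2 * k + 3)%nat by lia.
      apply (bigO_mul (fun z => z ^ (2 * k))%cx); [apply bigO_pow_id|apply bigO_pi_sub].
Qed.

(** Often only [pi_alpha] of an unknown map is known to be holomorphic; this bound recovers the size
    of the map itself. Near 0 the terms beyond [z ^ 2] consume at most half of it, whence the factor
    2. *)
Lemma pi_alpha_lower n alpha : exists d, 0 < d /\
  forall z, Cnorm z < d -> Cnorm z ^ 2 <= 2 * Cnorm (pi_alpha n alpha z).
Proof.
  destruct (bigO_pi_sub n alpha) as [C [d [HC [Hd H]]]].
  assert (P : 0 < / (2 * (C + 1))) by (apply Rinv_0_lt_compat; lra).
  exists (Rmin d (/ (2 * (C + 1)))). split; [now apply Rmin_glb_lt|]. intros z Hz.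
  pose proof (Rmin_l d (/ (2 * (C + 1)))); pose proof (Rmin_r d (/ (2 * (C + 1)))).
  specialize (H z ltac:(lra)). rewrite Cnorm_sub_sym in H.
  pose proof (Cnorm_sub_ge (z ^ 2)%cx (pi_alpha n alpha z)) as H3. rewrite Cnorm_pow in H3.
  pose proof (Cnorm_ge0 z) as Z.
  assert (C * Cnorm z <= 1 / 2).
  { apply Rle_trans with ((C + 1) * / (2 * (C + 1))); [nra|right; field; lra]. }
  assert (C * Cnorm z ^ 3 <= 1 / 2 * Cnorm z ^ 2).
  { replace (C * Cnorm z ^ 3) with (C * Cnorm z * Cnorm z ^ 2) by ring.
    apply Rmult_le_compat_r; [apply pow_le; assumption|assumption]. }
  lra.
Qed.

(* The leading terms of the powers of pi have even order, so they cannot interact with odd monomials. *)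
Lemma cusp_coeffs_zero n alpha (c gamma : nat -> Cx) :
  bigO (fun z => Csum (S n) (fun k => c k * pi_alpha n alpha z ^ k)
                 - Csum (S n) (fun k => gamma k * z ^ (2 * k + 1)))%cx (2 * n + 2) ->
  forall k, (k <= n)%nat -> c k = C0 /\ gamma k = C0.
Proof.
  intros H k. induction k as [k IH] using (well_founded_induction Nat.lt_wf_0). intros Hk.
  (* Coefficients below [k] vanish by induction, and the terms above [k] have order at least
     [2 * k + 2]. The remaining pair is then read at order [2 * k] for [c k] and at order
     [2 * k + 1] for [gamma k]. *)
  assert (E : bigO (fun z => c k * pi_alpha n alpha z ^ k - gamma k * z ^ (2 * k + 1))%cx (2 * k + 2)).
  { apply (bigO_ext (fun z =>
      (Csum (S n) (fun k => c k * pi_alpha n alpha z ^ k)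
        - Csum (S n) (fun k => gamma k * z ^ (2 * k + 1)))
      - (Csum (S n - S k) (fun i => c (S k + i)%nat * pi_alpha n alpha z ^ (S k + i))
         - Csum (S n - S k) (fun i => gamma (S k + i)%nat * z ^ (2 * (S k + i) + 1))))%cx).
    { intros z. rewrite !(Csum_split (S n) (S k)) by lia.
      change (Csum (S k) ?f) with (Csum k f + f k)%cx.
      rewrite (Csum_zero k (fun k => c k * pi_alpha n alpha z ^ k)%cx)
        by (intros j Hj; rewrite (proj1 (IH j Hj ltac:(lia))); ring).
      rewrite (Csum_zero k (fun k => gamma k * z ^ (2 * k + 1))%cx)
        by (intros j Hj; rewrite (proj2 (IH j Hj ltac:(lia))); ring).
      cbv beta. ring. }
    apply bigO_sub; [apply bigO_weaken with (2 * n + 2)%nat; [lia|exact H]|]. apply bigO_sub.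
    - apply (bigO_csum _ (fun i z => c (S k + i)%nat * pi_alpha n alpha z ^ (S k + i))%cx).
      intros i _. apply bigO_scal. apply bigO_weaken with ((S k + i) * 2)%nat; [lia|].
      apply bigO_pow, bigO_pi.
    - apply (bigO_csum _ (fun i z => gamma (S k + i)%nat * z ^ (2 * (S k + i) + 1))%cx).
      intros i _. apply bigO_scal. apply bigO_weaken with (2 * (S k + i) + 1)%nat; [lia|].
      apply bigO_pow_id. }
  assert (Hc : c k = C0).
  { apply (bigO_monomial _ (2 * k)).
    apply (bigO_ext (fun z => ((c k * pi_alpha n alpha z ^ k - gamma k * z ^ (2 * k + 1))
        - c k * (pi_alpha n alpha z ^ k - z ^ (2 * k))) + gamma k * z ^ (2 * k + 1))%cx);
      [intros; ring|].
    replace (S (2 * k)) with (2 * k + 1)%nat by lia.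
    apply bigO_add; [apply bigO_sub|apply bigO_scal, bigO_pow_id].
    - apply bigO_weaken with (2 * k + 2)%nat; [lia|exact E].
    - apply bigO_scal, bigO_pi_pow_sub. }
  split; [assumption|]. apply (bigO_monomial _ (2 * k + 1)).
  replace (S (2 * k + 1)) with (2 * k + 2)%nat by lia.
  apply (bigO_ext (fun z => (- C1) * (c k * pi_alpha n alpha z ^ k - gamma k * z ^ (2 * k + 1)))%cx).
  - intros z. rewrite Hc. ring.
  - now apply bigO_scal.
Qed.

Section Cusp.

Variables (n : nat) (alpha : nat -> Cx).

Lemma cusp_holo f : A_cusp n alpha f -> forall z, Disk z -> cdiff f z.
Proof.
  intros [c [g [Hg E]]] z Hz.
  apply (cdiff_disk_ext (fun z => Csum (S n) (fun k => c k * pi_alpha n alpha z ^ k)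
      + z ^ (2 * n + 2) * g z)%cx); [assumption|intros w Hw; now rewrite E|].
  apply (cdiff_add (fun z => Csum (S n) (fun k => c k * pi_alpha n alpha z ^ k)%cx)).
  - apply (cdiff_csum (S n) (fun k z => c k * pi_alpha n alpha z ^ k)%cx). intros k.
    apply (cdiff_mul (fun _ => c k)); [apply cdiff_const|].
    apply (cdiff_pow (pi_alpha n alpha)), cdiff_pi_alpha.
  - apply (cdiff_mul (fun z => z ^ (2 * n + 2))%cx); [apply (cdiff_pow (fun z => z)), cdiff_id|].
    now apply Hg.
Qed.

Lemma cusp_monomial g : holo_disk g -> A_cusp n alpha (fun z => z ^ (2 * n + 2) * g z)%cx.
Proof.
  intros Hg. exists (fun _ => C0), g. split; [assumption|]. intros z _.
  rewrite Csum_zero by (intros; ring). ring.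
Qed.

Lemma cusp_pi : (1 <= n)%nat -> A_cusp n alpha (pi_alpha n alpha).
Proof.
  intros Hn.
  exists (fun k => if Nat.eq_dec k 1 then C1 else C0), (fun _ => C0).
  split; [intros z _; apply cdiff_const|]. intros z _.
  rewrite (Csum_split (S n) 2) by lia. rewrite (Csum_zero (S n - 2)).
  - simpl. ring.
  - intros k _. destruct Nat.eq_dec; [lia|ring].
Qed.

(** Two consecutive exponents suffice: [z] is the quotient of [z ^ (2 * n + 3)] by [z ^ (2 * n + 2)]
    wherever the latter is nonzero, and the latter vanishes only at 0. *)
Lemma cusp_separates : separates_disk (A_cusp n alpha).
Proof.
  intros z w Hz Hw H.
  pose proof (H _ (cusp_monomial (fun _ => C1) (fun z _ => cdiff_const C1 z))) as H1.
  pose proof (H _ (cusp_monomial (fun z => z) (fun z _ => cdiff_id z))) as H2.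
  cbv beta in H1, H2.
  assert (E : (z ^ (2 * n + 2) = w ^ (2 * n + 2))%cx).
  { replace (z ^ (2 * n + 2))%cx with (z ^ (2 * n + 2) * C1)%cx by ring. rewrite H1. ring. }
  rewrite E in H2. destruct (classic (w = C0)) as [W|W].
  - rewrite W in *. replace (2 * n + 2)%nat with (S (2 * n + 1)) in E by lia.
    rewrite Cpow_C0 in E. now apply Cpow_eq0 in E.
  - apply Csub_eq0. destruct (Cmul_eq0 (w ^ (2 * n + 2))%cx (z - w)%cx) as [F|F]; [| |exact F].
    + replace (w ^ (2 * n + 2) * (z - w))%cx with (w ^ (2 * n + 2) * z - w ^ (2 * n + 2) * w)%cx by ring.
      rewrite H2. ring.
    + apply Cpow_eq0 in F. contradiction.
Qed.

(** This is the trace of the cusp that an equivalence must respect: no linear term at 0. The cubic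
    remainder, rather than a mere vanishing derivative, is what is later compared with [pi_alpha]
    along the inverse map. *)
Lemma cusp_jet2 f : (1 <= n)%nat -> A_cusp n alpha f ->
  exists c, bigO (fun z => f z - f C0 - c * z ^ 2)%cx 3.
Proof.
  intros Hn [c [g [Hg E]]].
  assert (Hb : bigO (fun z => f z - c 0%nat - c 1%nat * z ^ 2)%cx 3).
  { apply (bigO_ext_loc (fun z => (c 1%nat * (pi_alpha n alpha z - z ^ 2)
      + Csum (S n - 2) (fun k => c (2 + k)%nat * pi_alpha n alpha z ^ (2 + k)))
      + z ^ (2 * n + 2) * g z)%cx _ 3 1); [lra| |].
    - intros z Hz. rewrite (E z Hz). rewrite (Csum_split (S n) 2) by lia. simpl Csum at 2.
      change (pi_alpha n alpha z ^ 0)%cx with C1.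
      replace (pi_alpha n alpha z ^ 1)%cx with (pi_alpha n alpha z) by (simpl; ring). ring.
    - apply bigO_add; [apply bigO_add|].
      + apply bigO_scal, bigO_pi_sub.
      + apply (bigO_csum _ (fun k z => c (2 + k)%nat * pi_alpha n alpha z ^ (2 + k))%cx).
        intros i _. apply bigO_scal. apply bigO_weaken with ((2 + i) * 2)%nat; [lia|].
        apply bigO_pow, bigO_pi.
      + apply bigO_weaken with (2 * n + 2 + 0)%nat; [lia|].
        apply (bigO_mul (fun z => z ^ (2 * n + 2))%cx); [apply bigO_pow_id|].
        apply bigO_cont, cdiff_cont, Hg, Disk_C0. }
  exists (c 1%nat). pose proof (bigO_at_0 _ _ Hb) as Z. cbv beta in Z.
  assert (E0 : f C0 = c 0%nat).
  { apply Csub_eq0. etransitivity; [|exact Z]. ring. }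
  now rewrite E0.
Qed.

(** The growth hypothesis kills the polynomial part through [cusp_coeffs_zero] with all odd
    coefficients zero, so the cofactor is the [g] from the definition of the algebra and is
    holomorphic at 0 as well. *)
Lemma cusp_divide f : A_cusp n alpha f -> bigO f (2 * n + 2) ->
  exists g, holo_disk g /\ forall z, Disk z -> f z = (z ^ (2 * n + 2) * g z)%cx.
Proof.
  intros [c [g [Hg E]]] Hf. exists g; split; [assumption|]. intros z Hz. rewrite E by assumption.
  rewrite Csum_zero; [ring|]. intros k Hk.
  destruct (cusp_coeffs_zero n alpha c (fun _ => C0)) with (k := k) as [-> _]; [|lia|ring].
  apply (bigO_ext_loc (fun z => f z - z ^ (2 * n + 2) * g z)%cx _ _ 1); [lra| |].
  - intros w Hw. rewrite E by assumption.
    rewrite (Csum_zero (S n) (fun k => C0 * w ^ (2 * k + 1))%cx) by (intros; ring). ring.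
  - apply bigO_sub; [assumption|]. apply bigO_weaken with (2 * n + 2 + 0)%nat; [lia|].
    apply (bigO_mul (fun z => z ^ (2 * n + 2))%cx); [apply bigO_pow_id|].
    apply bigO_cont, cdiff_cont, Hg, Disk_C0.
Qed.

End Cusp.

(** * The Schwarz lemma *)

Lemma Csub_C0_r z : (z - C0)%cx = z.
Proof. ring. Qed.

(** At 0 the quotient is shown to be continuous and no more; [max_modulus] tolerates such a
    point. *)
Lemma slope_at_0 f : cdiff f C0 -> f C0 = C0 ->
  exists q, cont_at q C0 /\ (forall w, f w = (q w * w)%cx) /\
    forall w, w <> C0 -> cdiff f w -> cdiff q w.
Proof.
  intros [L HL] H0. apply cderiv_slope in HL. destruct HL as [q [Hq [_ E]]].
  rewrite H0 in E.
  assert (E' : forall w, f w = (q w * w)%cx).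
  { intros w. rewrite <- (Csub_C0_r (f w)), E. ring. }
  exists q. repeat split; try assumption.
  intros w Hw Hf.
  apply (cdiff_ext_loc (fun z => f z / z)%cx q w (Cnorm w)); [now apply Cnorm_pos| |].
  - intros z Hz. assert (z <> C0).
    { intros ->. rewrite Cnorm_sub_sym, Csub_C0_r in Hz. lra. }
    rewrite E'. field. assumption.
  - apply (cdiff_div f (fun z => z)); [assumption|apply cdiff_id|assumption].
Qed.

Lemma schwarz_lemma f : holo_disk f -> f C0 = C0 -> (forall z, Disk z -> Disk (f z)) ->
  forall z, Disk z -> Cnorm (f z) <= Cnorm z.
Proof.
  intros Hf H0 Hd z Hz.
  destruct (slope_at_0 f (Hf C0 Disk_C0) H0) as [q [Hq [E Hqd]]].
  assert (Hcont : forall w, Disk w -> cont_at q w).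
  { intros w Hw. destruct (classic (w = C0)) as [->|Hn]; [assumption|].
    apply cdiff_cont, Hqd; [assumption|now apply Hf]. }
  assert (Bound : forall r, Cnorm z <= r -> 0 < r < 1 -> Cnorm (q z) <= / r).
  { intros r Hzr Hr. apply (max_modulus q r); [lra| | | |assumption].
    - intros w Hw. apply Hcont. unfold Disk. lra.
    - intros c Hc. destruct (classic (c = C0)) as [->|Hn].
      + exists 1; split; [lra|]. intros w Hw. rewrite Csub_C0_r in Hw.
        apply Hqd; [apply Cnorm_pos_neq0; lra|apply Hf; unfold Disk; lra].
      + pose proof (Cnorm_pos c Hn) as Pc. exists (Rmin (Cnorm c) (1 - Cnorm c)).
        split; [apply Rmin_glb_lt; lra|]. intros w Hw.
        pose proof (Rmin_l (Cnorm c) (1 - Cnorm c)); pose proof (Rmin_r (Cnorm c) (1 - Cnorm c)).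
        pose proof (Cnorm_sub_ge w c); pose proof (Cnorm_sub_ge c w) as G.
        rewrite Cnorm_sub_sym in G.
        apply Hqd; [apply Cnorm_pos_neq0; lra|apply Hf; unfold Disk; lra].
    - intros w Hw. assert (Dw : Disk w) by (unfold Disk; lra).
      pose proof (Hd w Dw) as Hfw. unfold Disk in Hfw. rewrite E, Cnorm_mul, Hw in Hfw.
      left. apply Rmult_lt_reg_r with r; [lra|]. rewrite Rinv_l; lra. }
  rewrite E, Cnorm_mul. pose proof (Cnorm_ge0 z) as Z.
  enough (Cnorm (q z) <= 1) by nra. apply Rnot_lt_le. intros Hgt. unfold Disk in Hz.
  assert (I : 0 < / Cnorm (q z) < 1).
  { split; [apply Rinv_0_lt_compat; lra|]. rewrite <- Rinv_1. apply Rinv_lt_contravar; lra. }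
  (* Instead of letting the radius tend to 1, a single radius is chosen strictly between [mx] and 1:
     it exceeds [/ Cnorm (q z)], which contradicts [Bound]. *)
  set (mx := Rmax (Cnorm z) (/ Cnorm (q z))).
  assert (M1 : Cnorm z <= mx) by apply Rmax_l. assert (M2 : / Cnorm (q z) <= mx) by apply Rmax_r.
  assert (M3 : mx < 1) by (apply Rmax_lub_lt; lra).
  specialize (Bound ((mx + 1) / 2) ltac:(lra) ltac:(lra)).
  apply (Rmult_le_compat_r ((mx + 1) / 2)) in Bound; [|lra]. rewrite Rinv_l in Bound by lra.
  assert (Cnorm (q z) * / Cnorm (q z) < Cnorm (q z) * ((mx + 1) / 2))
    by (apply Rmult_lt_compat_l; lra).
  rewrite Rinv_r in H by lra. lra.
Qed.

(** Takes the place of the open mapping theorem. A step [h] along which [L * h] is a positive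
    multiple of [q z] gains [t * |L|^2] in the radial direction, while the differentiability error
    costs at most half of that. *)
Lemma unimodular_deriv_zero q z r L : 0 < r ->
  (forall w, Cnorm (w - z)%cx < r -> Cnorm (q w) = 1) -> is_cderiv q z L -> L = C0.
Proof.
  intros Hr Hu HL. apply NNPP; intros Hn.
  assert (Hz : Cnorm (q z) = 1) by (apply Hu; rewrite Cnorm_sub_diag; lra).
  set (M := (Conj (q z) * L)%cx).
  assert (NM : Cnorm M = Cnorm L) by (unfold M; rewrite Cnorm_mul, Cnorm_conj, Hz; ring).
  pose proof (Cnorm_pos L Hn) as PL.
  destruct (HL (Cnorm L / 2)) as [d [Pd Hd]]; [lra|].
  set (t := Rmin d r / 2 / Cnorm L).
  pose proof (Rmin_l d r); pose proof (Rmin_r d r).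
  assert (0 < Rmin d r) by now apply Rmin_glb_lt.
  assert (Pt : 0 < t) by (apply Rdiv_lt_0_compat; lra).
  (* the direction in which |q| increases fastest *)
  set (h := ((t, 0) * Conj M)%cx).
  assert (Nt : Cnorm (t, 0) = t) by (apply Cnorm_unique; simpl; lra).
  assert (Nh : Cnorm h = t * Cnorm L) by (unfold h; rewrite Cnorm_mul, Cnorm_conj, NM, Nt; ring).
  assert (Nh' : Cnorm h = Rmin d r / 2) by (rewrite Nh; unfold t; field; lra).
  set (w := (z + h)%cx).
  assert (Ew : (w - z)%cx = h) by (unfold w; ring).
  specialize (Hd w). rewrite Ew in Hd. specialize (Hd ltac:(lra)).
  assert (Hw : Cnorm (q w) = 1) by (apply Hu; rewrite Ew; lra).
  set (E := (q w - q z - L * h)%cx) in *.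
  pose proof (Cnorm_polarization (q z) (q w)) as Pol. rewrite Hz, Hw in Pol.
  assert (Eq : (Conj (q z) * q w)%cx = (Conj (q z) * q z + M * h + Conj (q z) * E)%cx)
    by (unfold E, M; ring).
  rewrite Eq in Pol.
  assert (F1 : fst (Conj (q z) * q z)%cx = 1).
  { pose proof (Cnorm_sqr (q z)) as S. rewrite Hz in S. simpl. lra. }
  assert (F2 : fst (M * h)%cx = t * (Cnorm L * Cnorm L)).
  { rewrite <- NM, Cnorm_sqr. unfold h. simpl. ring. }
  assert (F3 : - (Cnorm L / 2 * Cnorm h) <= fst (Conj (q z) * E)%cx).
  { pose proof (Cnorm_fst (Conj (q z) * E)%cx) as B. rewrite Cnorm_mul, Cnorm_conj, Hz in B.
    apply Rabs_le_between in B. lra. }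
  change (fst (Conj (q z) * q z + M * h + Conj (q z) * E)%cx)
    with (fst (Conj (q z) * q z)%cx + fst (M * h)%cx + fst (Conj (q z) * E)%cx) in Pol.
  rewrite F1, F2 in Pol. rewrite Nh in F3.
  assert (0 <= Cnorm (q w - q z)%cx * Cnorm (q w - q z)%cx)
    by (pose proof (Cnorm_ge0 (q w - q z)%cx); nra).
  assert (0 < t * (Cnorm L * Cnorm L)) by (apply Rmult_lt_0_compat; nra).
  nra.
Qed.

(** Reduces to a real function with zero derivative on an interval; [p] will be [fst] and [snd]. The
    segment stops short of 0, where [q] may only be continuous. *)
Lemma deriv_zero_ray (q : Cx -> Cx) z :
  (forall t, 0 < t <= 1 -> is_cderiv q ((t, 0) * z)%cx C0) ->
  forall e, 0 < e < 1 -> q ((e, 0) * z)%cx = q z.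
Proof.
  intros H e He.
  assert (D : forall (p : Cx -> R), (forall a b, Rabs (p a - p b) <= Cnorm (a - b)%cx) ->
     p (q ((e, 0) * z)%cx) = p (q z)).
  { intros p Hp.
    replace (q z) with (q ((1, 0) * z)%cx) by (f_equal; apply Cx_ext; simpl; ring).
    apply (eq_is_derive (fun t => p (q ((t, 0) * z)%cx)) e 1); [|lra].
    intros t Ht. apply is_derive_Reals. intros eps Heps.
    pose proof (Cnorm_ge0 z) as Z.
    destruct (H t ltac:(lra) (eps / 2 / (Cnorm z + 1))) as [d [Pd Hd]];
      [apply Rdiv_lt_0_compat; lra|].
    assert (Pd' : 0 < d / (Cnorm z + 1)) by (apply Rdiv_lt_0_compat; lra).
    exists (mkposreal _ Pd'). intros h Hh Hhd. simpl in Hhd.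
    assert (Ed : (((t + h)%R, 0) * z - (t, 0) * z)%cx = ((h, 0) * z)%cx)
      by (apply Cx_ext; simpl; ring).
    assert (Nh : Cnorm (h, 0) = Rabs h).
    { apply Cnorm_unique; [apply Rabs_pos|]. simpl. pose proof (Rsqr_abs h) as S.
      unfold Rsqr in S. lra. }
    pose proof (Rabs_pos_lt h Hh) as Ph.
    specialize (Hd (((t + h)%R, 0) * z)%cx). rewrite Ed, Cnorm_mul, Nh in Hd.
    assert (Hlt : Rabs h * Cnorm z < d).
    { apply Rle_lt_trans with (Rabs h * (Cnorm z + 1)); [apply Rmult_le_compat_l; lra|].
      apply Rlt_le_trans with (d / (Cnorm z + 1) * (Cnorm z + 1));
        [apply Rmult_lt_compat_r; lra|right; field; lra]. }
    specialize (Hd Hlt). unfold zero; simpl.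
    replace (q (((t + h)%R, 0) * z) - q ((t, 0) * z) - C0 * ((h, 0) * z))%cx
      with (q (((t + h)%R, 0) * z) - q ((t, 0) * z))%cx in Hd by ring.
    rewrite Rminus_0_r. unfold Rdiv at 1. rewrite Rabs_mult, Rabs_inv.
    apply Rmult_lt_reg_r with (Rabs h); [assumption|].
    rewrite Rmult_assoc, Rinv_l, Rmult_1_r by lra.
    eapply Rle_lt_trans; [apply Hp|]. eapply Rle_lt_trans; [exact Hd|].
    apply Rle_lt_trans with (eps / 2 / (Cnorm z + 1) * (Rabs h * (Cnorm z + 1))).
    - apply Rmult_le_compat_l; [left; apply Rdiv_lt_0_compat; lra|].
      apply Rmult_le_compat_l; lra.
    - replace (eps / 2 / (Cnorm z + 1) * (Rabs h * (Cnorm z + 1))) with (eps / 2 * Rabs h)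
        by (field; lra).
      apply Rmult_lt_compat_r; lra. }
  apply Cx_ext; apply D; intros a b.
  - exact (Cnorm_fst (a - b)%cx).
  - exact (Cnorm_snd (a - b)%cx).
Qed.

(** The slope [q] of [f] has modulus 1 off 0, hence zero derivative there, hence is constant along
    each radius. All radii end at 0, where [q] is continuous, so they share the value [q C0]. *)
Lemma modulus_preserving_rotation f : holo_disk f -> (forall z, Disk z -> Cnorm (f z) = Cnorm z) ->
  exists tau, Cnorm tau = 1 /\ forall z, Disk z -> f z = (tau * z)%cx.
Proof.
  intros Hf HN.
  assert (H0 : f C0 = C0) by (apply Cnorm_eq0; rewrite HN, Cnorm_C0 by apply Disk_C0; reflexivity).
  destruct (slope_at_0 f (Hf C0 Disk_C0) H0) as [q [Hq [E Hqd]]].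
  assert (Hu : forall w, Disk w -> w <> C0 -> Cnorm (q w) = 1).
  { intros w Hw Hn. pose proof (HN w Hw) as H. rewrite E, Cnorm_mul in H.
    pose proof (Cnorm_pos w Hn). apply Rmult_eq_reg_r with (Cnorm w); lra. }
  assert (Hray : forall z, Disk z -> z <> C0 -> q z = q C0).
  { intros z Hz Hn. apply Csub_eq0, NNPP. intros Hne.
    pose proof (Cnorm_pos z Hn) as Pz. unfold Disk in Hz.
    assert (Hall : forall e, 0 < e < 1 -> q ((e, 0) * z)%cx = q z).
    { apply deriv_zero_ray. intros t Ht.
      set (w := ((t, 0) * z)%cx).
      assert (Nw : Cnorm w = t * Cnorm z).
      { unfold w. rewrite Cnorm_mul. f_equal. apply Cnorm_unique; simpl; lra. }
      assert (Pw : 0 < Cnorm w < 1) by (rewrite Nw; nra).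
      assert (Hwn : w <> C0) by (apply Cnorm_pos_neq0; lra).
      assert (Hdw : Disk w) by (unfold Disk; lra).
      destruct (Hqd w Hwn (Hf w Hdw)) as [L HL].
      replace C0 with L; [assumption|].
      apply (unimodular_deriv_zero q w (Rmin (Cnorm w) (1 - Cnorm w)) L); [| |assumption].
      - apply Rmin_glb_lt; lra.
      - intros v Hv.
        pose proof (Rmin_l (Cnorm w) (1 - Cnorm w)); pose proof (Rmin_r (Cnorm w) (1 - Cnorm w)).
        pose proof (Cnorm_sub_ge v w); pose proof (Cnorm_sub_ge w v) as G.
        rewrite Cnorm_sub_sym in G.
        apply Hu; [unfold Disk; lra|apply Cnorm_pos_neq0; lra]. }
    destruct (Hq (Cnorm (q z - q C0)%cx)) as [d [Pd Hd]]; [now apply Cnorm_pos|].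
    set (e := Rmin (1/2) (d / 2 / Cnorm z)).
    assert (He1 : e <= 1/2) by apply Rmin_l. assert (He2 : e <= d / 2 / Cnorm z) by apply Rmin_r.
    assert (He : 0 < e) by (apply Rmin_glb_lt; [lra|apply Rdiv_lt_0_compat; lra]).
    specialize (Hd ((e, 0) * z)%cx). rewrite Csub_C0_r, Cnorm_mul in Hd.
    replace (Cnorm (e, 0)) with e in Hd by (symmetry; apply Cnorm_unique; simpl; lra).
    rewrite (Hall e) in Hd by lra.
    apply (Rmult_le_compat_r (Cnorm z)) in He2; [|lra].
    replace (d / 2 / Cnorm z * Cnorm z) with (d / 2) in He2 by (field; lra).
    specialize (Hd ltac:(lra)). lra. }
  exists (q C0). split.
  - destruct (small_point 1) as [z [Hn Hz]]; [lra|]. rewrite <- (Hray z) by assumption.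
    now apply Hu.
  - intros z Hz. rewrite E. destruct (classic (z = C0)) as [->|Hn]; [ring|].
    now rewrite Hray.
Qed.

(** * Absence of a continuous square root around a circle *)

Lemma cexp_half_turn t : (cexp (0, - (t / 2))%R * cexp (0, - (t / 2))%R * cexp (0, t))%cx = C1.
Proof.
  rewrite <- !cexp_add. unfold cexp. simpl.
  replace (0 + 0 + 0) with 0 by ring. replace (- (t / 2) + - (t / 2) + t) with 0 by field.
  rewrite exp_0, cos_0, sin_0. apply Cx_ext; simpl; ring.
Qed.

(** Along the circle, let [x] be [psi] times [exp (- i t / 2)]. The hypothesis puts [x * x] in a
    disk about a positive number that stays in the right half-plane, so the real part of [x] never
    vanishes. But a full turn changes [x] into [- x], and the intermediate value theorem gives a
    zero. *)
Lemma no_square_root_on_circle psi b kappa rho : kappa <> C0 -> 0 < rho ->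
  (forall w, Cnorm (w - b)%cx = rho -> cont_at psi w) ->
  ~ (forall w, Cnorm (w - b)%cx = rho ->
       Cnorm (psi w ^ 2 - kappa * (w - b))%cx < Cnorm kappa * rho).
Proof.
  intros Hk Hr Hc Hbad. pose proof (Cnorm_pos kappa Hk) as Pk.
  (* normalised so that kappa (w - b) = |kappa| rho e^{it} along the circle *)
  set (a := ((rho / Cnorm kappa, 0)%R * Conj kappa)%cx).
  assert (Na : Cnorm a = rho).
  { unfold a. rewrite Cnorm_mul, Cnorm_conj.
    replace (Cnorm (rho / Cnorm kappa, 0)) with (rho / Cnorm kappa); [field; lra|].
    symmetry; apply Cnorm_unique; simpl; [left; now apply Rdiv_lt_0_compat|ring]. }
  assert (Ka : (kappa * a)%cx = (Cnorm kappa * rho, 0)).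
  { pose proof (Cnorm_sqr kappa) as S. unfold a. apply Cx_ext; simpl; [|ring].
    transitivity (rho / Cnorm kappa * (fst kappa * fst kappa + snd kappa * snd kappa)); [ring|].
    rewrite <- S. field. lra. }
  set (F := fun z => (psi (b + a * cexp z) * cexp (z * (- (1 / 2), 0)%R))%cx).
  set (q := fun t => fst (F (0, t))).
  assert (Nw : forall t, Cnorm (b + a * cexp (0, t) - b)%cx = rho).
  { intros t. replace (b + a * cexp (0, t) - b)%cx with (a * cexp (0, t))%cx by ring.
    rewrite Cnorm_mul, Cnorm_cexp, Na. simpl. rewrite exp_0. ring. }
  assert (Hq : continuity q).
  { intros t. assert (CF : cont_at F (0, t)).
    { unfold F. apply (cont_mul (fun z => psi (b + a * cexp z)%cx)).
      - apply (cont_comp (fun z => b + a * cexp z)%cx psi); [|apply Hc, Nw].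
        apply (cont_add (fun _ => b)); [apply cont_const|].
        apply (cont_mul (fun _ => a)); [apply cont_const|apply cdiff_cont, cdiff_cexp].
      - apply (cont_comp (fun z => z * (- (1 / 2), 0)%R)%cx cexp); [|apply cdiff_cont, cdiff_cexp].
        apply (cont_mul (fun z => z)); [apply cont_id|apply cont_const]. }
    apply continuity_pt_filterlim. apply continuous_eps. intros e He.
    destruct (CF e He) as [d [Pd Hd]]. exists d; split; [assumption|]. intros y Hy.
    eapply Rle_lt_trans; [|apply (Hd (0, y))].
    - unfold q. exact (Cnorm_fst (F (0, y) - F (0, t))%cx).
    - eapply Rle_lt_trans; [apply Cnorm_le_sum|]. simpl.
      rewrite Ropp_0, Rplus_0_r, Rabs_R0, Rplus_0_l. exact Hy. }
  assert (Fq : forall t, F (0, t) = (psi (b + a * cexp (0, t)) * cexp (0, - (t / 2))%R)%cx).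
  { intros t. unfold F. f_equal. f_equal. apply Cx_ext; simpl; field. }
  pose proof PI_RGT_0.
  destruct (IVT_cor q 0 (2 * PI) Hq) as [t [Ht Hz]]; [lra| |].
  { unfold q. rewrite !Fq.
    assert (E1 : cexp (0, - (0 / 2)) = C1).
    { unfold cexp; simpl. replace (- (0 / 2)) with 0 by field.
      rewrite exp_0, cos_0, sin_0. apply Cx_ext; simpl; ring. }
    assert (E2 : cexp (0, - (2 * PI / 2)) = (- C1)%cx).
    { unfold cexp; simpl. replace (- (2 * PI / 2)) with (- PI) by field.
      rewrite exp_0, cos_neg, sin_neg, cos_PI, sin_PI. apply Cx_ext; simpl; ring. }
    assert (E3 : cexp (0, 2 * PI) = cexp (0, 0)).
    { unfold cexp; simpl. now rewrite cos_2PI, sin_2PI, cos_0, sin_0. }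
    rewrite E1, E2, E3. set (p := psi (b + a * cexp (0, 0))%cx). simpl. nra. }
  set (x := F (0, t)) in *. unfold q in Hz. fold x in Hz.
  specialize (Hbad _ (Nw t)). set (w := (b + a * cexp (0, t))%cx) in *.
  set (u := cexp (0, - (t / 2))) in *.
  assert (Ex : (x * x - (Cnorm kappa * rho, 0)%R)%cx = ((psi w ^ 2 - kappa * (w - b)) * (u * u))%cx).
  { replace (kappa * (w - b))%cx with (kappa * a * cexp (0, t))%cx by (unfold w; ring).
    rewrite Ka. unfold x. rewrite Fq. fold w u.
    replace ((psi w ^ 2 - (Cnorm kappa * rho, 0)%R * cexp (0, t)) * (u * u))%cx
      with (psi w ^ 2 * (u * u) - (Cnorm kappa * rho, 0)%R * (u * u * cexp (0, t)))%cx by ring.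
    unfold u. rewrite cexp_half_turn. ring. }
  assert (Nu : Cnorm u = 1) by (unfold u; rewrite Cnorm_cexp; simpl; apply exp_0).
  assert (Nx : Cnorm (x * x - (Cnorm kappa * rho, 0)%R)%cx < Cnorm kappa * rho).
  { rewrite Ex, !Cnorm_mul, Nu. lra. }
  clearbody x. pose proof (Cnorm_fst (x * x - (Cnorm kappa * rho, 0)%R)%cx) as B.
  apply Rabs_le_between in B. simpl in B. rewrite Hz in B. nra.
Qed.

(** * Equivalences of cusp algebras are rotations *)

Definition cusp_equiv (n : nat) (alpha beta : nat -> Cx) : (Cx -> Cx) -> (Cx -> Cx) -> Prop :=
  algebra_equiv (A_cusp n alpha) (A_cusp n beta).

Lemma cusp_equiv_pullback n alpha beta theta psi g : cusp_equiv n alpha beta theta psi ->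
  holo_disk g -> A_cusp n alpha (fun z => theta z ^ (2 * n + 2) * g (theta z))%cx.
Proof.
  intros [_ [_ [_ [_ [H _]]]]] Hg.
  exact (H (fun w => w ^ (2 * n + 2) * g w)%cx (cusp_monomial n beta g Hg)).
Qed.

(* theta = theta^(2n+3) / theta^(2n+2), and both powers lie in the algebra of alpha *)
Lemma cusp_equiv_cdiff n alpha beta theta psi z : cusp_equiv n alpha beta theta psi ->
  Disk z -> theta z <> C0 -> cdiff theta z.
Proof.
  intros H Hz Hn.
  pose proof (cusp_holo n alpha _ (cusp_equiv_pullback _ _ _ _ _ _ H (fun w _ => cdiff_const C1 w)) z Hz) as D1.
  pose proof (cusp_holo n alpha _ (cusp_equiv_pullback _ _ _ _ _ _ H (fun w _ => cdiff_id w)) z Hz) as D2.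
  cbv beta in D1, D2.
  assert (Hne : (theta z ^ (2 * n + 2) * C1)%cx <> C0)
    by (apply Cmul_neq0; [now apply Cpow_neq0|apply C1_neq_C0]).
  destruct (cont_nonzero _ z (cdiff_cont _ _ D1) Hne) as [d [Pd Hd]]. cbv beta in Hd.
  apply (cdiff_ext_loc (fun z => (theta z ^ (2 * n + 2) * theta z) / (theta z ^ (2 * n + 2) * C1))%cx
     theta z d); [assumption| |].
  - intros w Hw. specialize (Hd w Hw). pose proof (Cnorm_pos _ Hne).
    assert (Hw0 : (theta w ^ (2 * n + 2) * C1)%cx <> C0) by (apply Cnorm_pos_neq0; lra).
    assert (Hw1 : (theta w ^ (2 * n + 2))%cx <> C0).
    { intros E. apply Hw0. rewrite E. ring. }
    generalize dependent (theta w ^ (2 * n + 2))%cx. intros. field. assumption.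
  - now apply (cdiff_div (fun z => theta z ^ (2 * n + 2) * theta z)%cx).
Qed.

Lemma cusp_equiv_cont n alpha beta theta psi z : cusp_equiv n alpha beta theta psi ->
  Disk z -> cont_at theta z.
Proof.
  intros H Hz. destruct (classic (theta z = C0)) as [Z|Hn].
  - pose proof (cusp_holo n alpha _ (cusp_equiv_pullback _ _ _ _ _ _ H (fun w _ => cdiff_const C1 w)) z Hz) as D1.
    apply cdiff_cont in D1. intros e He.
    destruct (D1 (e ^ (2 * n + 2))) as [d [Pd Hd]]; [now apply pow_lt|].
    exists d; split; [assumption|]. intros w Hw. specialize (Hd w Hw). cbv beta in Hd.
    rewrite Z in *. rewrite Csub_C0_r.
    replace (theta w ^ (2 * n + 2) * C1 - C0 ^ (2 * n + 2) * C1)%cx with (theta w ^ (2 * n + 2))%cx in Hd.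
    + rewrite Cnorm_pow in Hd. apply Rnot_le_lt. intros Hle.
      assert (e ^ (2 * n + 2) <= Cnorm (theta w) ^ (2 * n + 2)) by (apply pow_incr; lra). lra.
    + replace (2 * n + 2)%nat with (S (2 * n + 1)) by lia. rewrite Cpow_C0. ring.
  - apply cdiff_cont. now apply (cusp_equiv_cdiff n alpha beta theta psi).
Qed.

(* If theta 0 = b <> 0 then near b the inverse psi would be a continuous square root of a
   nonzero multiple of w - b, up to o(w - b): the functions of A(alpha) have no linear term at 0
   while w^(2n+2) (w - b) has a simple zero at b. *)
Lemma cusp_equiv_fixes_0 n alpha beta theta psi : (1 <= n)%nat ->
  cusp_equiv n alpha beta theta psi -> theta C0 = C0.
Proof.
  intros Hn H. apply NNPP; intros Hb. set (b := theta C0) in *.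
  pose proof (algebra_equiv_sym _ _ _ _ H) as H'.
  pose proof H as [Dt [Dp [Etp [Ept [Pt Pp]]]]].
  assert (Db : Disk b) by (apply Dt, Disk_C0).
  assert (Pb : psi b = C0) by (apply Etp, Disk_C0).
  assert (Hg : holo_disk (fun w => w - b)%cx).
  { intros w _. apply (cdiff_sub (fun w => w)); [apply cdiff_id|apply cdiff_const]. }
  destruct (cusp_jet2 n alpha _ Hn (cusp_equiv_pullback _ _ _ _ _ _ H Hg)) as [c [C [d1 [HC [Pd1 J]]]]].
  fold b in J. cbv beta in J.
  destruct (cusp_holo n beta _ (Pp _ (cusp_pi n alpha Hn)) b Db) as [L HL].
  destruct (HL 1) as [d2 [Pd2 Hd2]]; [lra|]. cbv beta in Hd2.
  destruct (pi_alpha_lower n alpha) as [d3 [Pd3 Hd3]].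
  (* [pi_alpha] of [psi] is differentiable at [b] with derivative [L], so it is at most
     [(|L| + 1) |w - b|]; [pi_alpha_lower] doubles this into a bound for [|psi w|^2]. *)
  set (K := 2 * (Cnorm L + 1)). assert (HK : 0 < K) by (pose proof (Cnorm_ge0 L); unfold K; lra).
  set (B := Cnorm (b ^ (2 * n + 2))%cx).
  assert (PB : 0 < B) by (apply Cnorm_pos, Cpow_neq0, Hb).
  (* Once [|psi w| <= eta], the cubic remainder [C |psi w|^3] is at most [C * eta * K |w - b|], a
     quarter of [B |w - b|]. The added 1 covers [C = 0]. *)
  set (eta := B / 4 / (C * K + 1)).
  assert (PCK : 0 <= C * K) by (apply Rmult_le_pos; lra).
  assert (Peta : 0 < eta) by (apply Rdiv_lt_0_compat; lra).
  destruct (cusp_equiv_cont _ _ _ _ _ b H' Db (Rmin eta (Rmin d1 d3))) as [d4 [Pd4 Hd4]];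
    [repeat apply Rmin_glb_lt; assumption|].
  destruct (cont_pow (fun w => w) b (2 * n + 2) (cont_id b) (B / 4)) as [d5 [Pd5 Hd5]]; [lra|].
  destruct (Disk_open b Db) as [d6 [Pd6 Hd6]].
  set (d := Rmin (Rmin d2 d4) (Rmin d5 d6)).
  assert (Pd : 0 < d) by (repeat apply Rmin_glb_lt; assumption).
  assert (Hdle : d <= d2 /\ d <= d4 /\ d <= d5 /\ d <= d6).
  { pose proof (Rmin_l (Rmin d2 d4) (Rmin d5 d6)); pose proof (Rmin_r (Rmin d2 d4) (Rmin d5 d6)).
    pose proof (Rmin_l d2 d4); pose proof (Rmin_r d2 d4).
    pose proof (Rmin_l d5 d6); pose proof (Rmin_r d5 d6). unfold d. lra. }
  clearbody d.
  (* One quarter of [B] pays for freezing [w ^ (2 * n + 2)] at [b], another for the cubic remainder;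
     their sum is below the threshold [B] of [no_square_root_on_circle]. *)
  assert (Main : forall w, Cnorm (w - b)%cx < d ->
     Cnorm (c * psi w ^ 2 - b ^ (2 * n + 2) * (w - b))%cx <= B / 2 * Cnorm (w - b)%cx).
  { intros w Hw. set (s := Cnorm (w - b)%cx) in *. assert (Hs : 0 <= s) by apply Cnorm_ge0.
    assert (Dw : Disk w) by (apply Hd6; fold s; lra).
    specialize (Hd4 w ltac:(fold s; lra)). rewrite Pb, Csub_C0_r in Hd4.
    pose proof (Rmin_l eta (Rmin d1 d3)); pose proof (Rmin_r eta (Rmin d1 d3)).
    pose proof (Rmin_l d1 d3); pose proof (Rmin_r d1 d3).
    specialize (Hd2 w ltac:(fold s; lra)). rewrite Pb, pi_alpha_C0, Csub_C0_r in Hd2. fold s in Hd2.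
    specialize (Hd3 (psi w) ltac:(lra)).
    assert (HP : Cnorm (psi w) ^ 2 <= K * s).
    { pose proof (Cnorm_sub_ge (pi_alpha n alpha (psi w)) (L * (w - b))%cx) as G.
      rewrite Cnorm_mul in G. fold s in G. unfold K. lra. }
    specialize (J (psi w) ltac:(lra)). rewrite Ept in J by assumption.
    replace (w ^ (2 * n + 2) * (w - b) - b ^ (2 * n + 2) * (b - b) - c * psi w ^ 2)%cx
      with (w ^ (2 * n + 2) * (w - b) - c * psi w ^ 2)%cx in J by ring.
    specialize (Hd5 w ltac:(fold s; lra)). cbv beta in Hd5.
    replace (c * psi w ^ 2 - b ^ (2 * n + 2) * (w - b))%cx
      with ((w ^ (2 * n + 2) - b ^ (2 * n + 2)) * (w - b) -
            (w ^ (2 * n + 2) * (w - b) - c * psi w ^ 2))%cx by ring.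
    eapply Rle_trans; [apply Cnorm_sub_le|]. rewrite (Cnorm_mul (_ - _)%cx (w - b)%cx). fold s.
    assert (T1 : Cnorm (w ^ (2 * n + 2) - b ^ (2 * n + 2))%cx * s <= B / 4 * s)
      by (apply Rmult_le_compat_r; lra).
    assert (T2 : C * Cnorm (psi w) ^ 3 <= B / 4 * s).
    { pose proof (Cnorm_ge0 (psi w)) as Np.
      apply Rle_trans with (C * (eta * (K * s))).
      - apply Rmult_le_compat_l; [assumption|].
        replace (Cnorm (psi w) ^ 3) with (Cnorm (psi w) * Cnorm (psi w) ^ 2) by ring.
        apply Rmult_le_compat; try lra. apply pow_le; lra.
      - replace (C * (eta * (K * s))) with (eta * (C * K) * s) by ring.
        apply Rmult_le_compat_r; [assumption|].
        apply Rle_trans with (eta * (C * K + 1)); [apply Rmult_le_compat_l; lra|].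
        right. unfold eta. field. lra. }
    lra. }
  (* If the quadratic coefficient vanished, [Main] would bound [B |h|] by half of itself. *)
  destruct (classic (c = C0)) as [Zc|Hc].
  - destruct (small_point d Pd) as [h [Hh Hhd]]. specialize (Main (b + h)%cx).
    replace (b + h - b)%cx with h in Main by ring. specialize (Main Hhd). rewrite Zc in Main.
    replace (C0 * psi (b + h) ^ 2 - b ^ (2 * n + 2) * h)%cx with (- (b ^ (2 * n + 2) * h))%cx in Main by ring.
    rewrite Cnorm_opp, Cnorm_mul in Main. fold B in Main. pose proof (Cnorm_pos h Hh). nra.
  - pose proof (Cnorm_pos c Hc) as Pc.
    apply (no_square_root_on_circle psi b (b ^ (2 * n + 2) / c)%cx (d / 2)).
    + apply Cmul_neq0; [now apply Cpow_neq0|now apply Cinv_neq0].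
    + lra.
    + intros w Hw. apply (cusp_equiv_cont _ _ _ _ _ w H'). apply Hd6. lra.
    + intros w Hw. specialize (Main w ltac:(lra)). rewrite Hw in Main.
      rewrite Cnorm_div by assumption. fold B.
      replace (psi w ^ 2 - b ^ (2 * n + 2) / c * (w - b))%cx
        with ((c * psi w ^ 2 - b ^ (2 * n + 2) * (w - b)) / c)%cx by (field; assumption).
      rewrite Cnorm_div by assumption. unfold Rdiv at 1.
      replace (B / Cnorm c * (d / 2)) with ((B * (d / 2)) * / Cnorm c) by (field; lra).
      apply Rmult_lt_compat_r; [now apply Rinv_0_lt_compat|].
      apply Rle_lt_trans with (1 := Main). nra.
Qed.

(** [pi_alpha n beta] of [theta] lies in A(alpha) and vanishes at 0, so it is quadratically small;
    as it also dominates [theta ^ 2], [theta] is at most linear. *)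
Lemma cusp_equiv_linear_bound n alpha beta theta psi : (1 <= n)%nat ->
  cusp_equiv n alpha beta theta psi -> bigO theta 1.
Proof.
  intros Hn H. pose proof (cusp_equiv_fixes_0 n alpha beta theta psi Hn H) as H0.
  pose proof H as [Dt [Dp [Etp [Ept [Pt Pp]]]]].
  destruct (cusp_jet2 n alpha _ Hn (Pt _ (cusp_pi n beta Hn))) as [c J].
  cbv beta in J. rewrite H0, pi_alpha_C0 in J.
  assert (J2 : bigO (fun z => pi_alpha n beta (theta z)) 2).
  { apply (bigO_ext (fun z => (pi_alpha n beta (theta z) - C0 - c * z ^ 2) + c * z ^ 2)%cx);
      [intros; ring|].
    apply bigO_add; [apply bigO_weaken with 3%nat; [lia|exact J]|apply bigO_scal, bigO_pow_id]. }
  destruct J2 as [C [d1 [HC [Pd1 J2]]]].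
  destruct (pi_alpha_lower n beta) as [d2 [Pd2 Hd2]].
  destruct (cusp_equiv_cont _ _ _ _ _ C0 H Disk_C0 d2 Pd2) as [d3 [Pd3 Hd3]].
  (* A constant whose square exceeds [2 * C], which avoids a square root. *)
  exists (2 * C + 1), (Rmin d1 d3). repeat split; [lra|now apply Rmin_glb_lt|].
  intros z Hz. pose proof (Rmin_l d1 d3); pose proof (Rmin_r d1 d3).
  specialize (J2 z ltac:(lra)). specialize (Hd3 z). rewrite H0, !Csub_C0_r in Hd3.
  specialize (Hd2 (theta z) (Hd3 ltac:(lra))).
  pose proof (Cnorm_ge0 z); pose proof (Cnorm_ge0 (theta z)).
  rewrite pow_1. apply Rsqr_incr_0_var; [|nra]. unfold Rsqr.
  assert (0 <= Cnorm z ^ 2) by (apply pow_le; assumption).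
  assert (Cnorm (theta z) ^ 2 <= (2 * C) * Cnorm z ^ 2) by lra.
  assert ((2 * C) * Cnorm z ^ 2 <= (2 * C + 1) * (2 * C + 1) * Cnorm z ^ 2)
    by (apply Rmult_le_compat_r; [assumption|nra]).
  simpl in *. lra.
Qed.

Lemma cont_eq_punctured f g : cont_at f C0 -> cont_at g C0 ->
  (forall z, Disk z -> z <> C0 -> f z = g z) -> f C0 = g C0.
Proof.
  intros Hf Hg E. apply Csub_eq0, NNPP; intros Hn. pose proof (Cnorm_pos _ Hn) as P.
  destruct (cont_nonzero _ _ (cont_sub f g C0 Hf Hg) Hn) as [d [Pd Hd]]. cbv beta in Hd.
  destruct (small_point (Rmin d 1)) as [z [Hz Hzd]]; [apply Rmin_glb_lt; lra|].
  pose proof (Rmin_l d 1); pose proof (Rmin_r d 1).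
  specialize (Hd z). rewrite Csub_C0_r in Hd. specialize (Hd ltac:(lra)).
  rewrite (E z), Csub_diag, Cnorm_C0 in Hd; [lra|unfold Disk; lra|assumption].
Qed.

(** Dividing [theta ^ (2 * n + 2)] and [theta ^ (2 * n + 3)] by the same power of [z] gives
    holomorphic [g] and [g1] with [theta = g1 / g]. The linear bound for [theta] permits the
    division; the linear bound for its inverse gives [|z| <= C |theta z|] near 0 and so keeps [g]
    away from zero there. *)
Lemma cusp_equiv_holo n alpha beta theta psi : (1 <= n)%nat ->
  cusp_equiv n alpha beta theta psi -> holo_disk theta.
Proof.
  intros Hn H. pose proof (algebra_equiv_sym _ _ _ _ H) as H'.
  pose proof (cusp_equiv_fixes_0 n alpha beta theta psi Hn H) as H0.
  pose proof (cusp_equiv_linear_bound n alpha beta theta psi Hn H) as Ot.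
  pose proof (cusp_equiv_linear_bound n beta alpha psi theta Hn H') as [C [d1 [HC [Pd1 Op]]]].
  pose proof H as [Dt [Dp [Etp [Ept [Pt Pp]]]]].
  assert (Om : bigO (fun z => theta z ^ (2 * n + 2))%cx (2 * n + 2)).
  { apply bigO_weaken with ((2 * n + 2) * 1)%nat; [lia|]. now apply bigO_pow. }
  destruct (cusp_divide n alpha _
     (cusp_equiv_pullback _ _ _ _ _ _ H (fun w _ => cdiff_const C1 w))) as [g [Hg Eg]].
  { apply (bigO_ext (fun z => theta z ^ (2 * n + 2))%cx); [intros; ring|assumption]. }
  destruct (cusp_divide n alpha _
     (cusp_equiv_pullback _ _ _ _ _ _ H (fun w _ => cdiff_id w))) as [g1 [Hg1 Eg1]].
  { apply bigO_weaken with (2 * n + 2 + 1)%nat; [lia|].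
    now apply (bigO_mul (fun z => theta z ^ (2 * n + 2))%cx). }
  cbv beta in Eg, Eg1.
  assert (Eq : forall z, Disk z -> z <> C0 -> (g z * theta z)%cx = g1 z).
  { intros z Hz Hnz. pose proof (Cpow_neq0 z (2 * n + 2) Hnz) as Hp.
    pose proof (Eg z Hz) as E1. pose proof (Eg1 z Hz) as E2.
    apply Csub_eq0. destruct (Cmul_eq0 (z ^ (2 * n + 2))%cx (g z * theta z - g1 z)%cx) as [F|F];
      [|contradiction|exact F].
    replace (z ^ (2 * n + 2) * (g z * theta z - g1 z))%cx
      with ((z ^ (2 * n + 2) * g z) * theta z - z ^ (2 * n + 2) * g1 z)%cx by ring.
    rewrite <- E1, <- E2. ring. }
  assert (Cg : cont_at g C0) by (apply cdiff_cont, Hg, Disk_C0).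
  assert (Ct : cont_at theta C0) by (apply (cusp_equiv_cont _ _ _ _ _ C0 H Disk_C0)).
  assert (Eq0 : (g C0 * theta C0)%cx = g1 C0).
  { apply (cont_eq_punctured (fun z => g z * theta z)%cx g1); [now apply cont_mul| |assumption].
    apply cdiff_cont, Hg1, Disk_C0. }
  assert (Hgn : forall z, Disk z -> g z <> C0).
  { intros z Hz Z. destruct (classic (z = C0)) as [->|Hnz].
    - destruct (Ct d1 Pd1) as [d2 [Pd2 Hd2]]. rewrite H0 in Hd2.
      (* Off 0 the bound on the inverse forces [|g z|] to be at least [e] near 0, against
         [g C0 = C0] and continuity. [C + 1] is invertible even if [C] is zero. *)
      set (e := / (C + 1) ^ (2 * n + 2)).
      assert (PC : 0 < (C + 1) ^ (2 * n + 2)) by (apply pow_lt; lra).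
      assert (Pe : 0 < e) by (now apply Rinv_0_lt_compat).
      destruct (Cg e Pe) as [d3 [Pd3 Hd3]]. rewrite Z in Hd3.
      destruct (small_point (Rmin (Rmin d2 d3) 1)) as [z [Hz0 Hzd]];
        [repeat apply Rmin_glb_lt; lra|].
      pose proof (Rmin_l (Rmin d2 d3) 1); pose proof (Rmin_r (Rmin d2 d3) 1).
      pose proof (Rmin_l d2 d3); pose proof (Rmin_r d2 d3).
      assert (Hdz : Disk z) by (unfold Disk; lra).
      specialize (Hd2 z). specialize (Hd3 z). rewrite !Csub_C0_r in Hd2, Hd3.
      specialize (Hd2 ltac:(lra)). specialize (Hd3 ltac:(lra)).
      specialize (Op (theta z) Hd2). rewrite Etp, pow_1 in Op by assumption.
      pose proof (Cnorm_pos z Hz0) as Pz. pose proof (Cnorm_ge0 (theta z)).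
      assert (Hle : Cnorm z ^ (2 * n + 2) <= ((C + 1) * Cnorm (theta z)) ^ (2 * n + 2))
        by (apply pow_incr; lra).
      rewrite Rpow_mult_distr in Hle.
      assert (E1 := Eg z Hdz). apply (f_equal Cnorm) in E1.
      rewrite !Cnorm_mul, !Cnorm_pow, Cnorm_C1, Rmult_1_r in E1. rewrite E1 in Hle.
      pose proof (pow_lt _ (2 * n + 2) Pz) as Pzm.
      assert ((C + 1) ^ (2 * n + 2) * (Cnorm z ^ (2 * n + 2) * Cnorm (g z)) < Cnorm z ^ (2 * n + 2)).
      { apply Rlt_le_trans with ((C + 1) ^ (2 * n + 2) * (Cnorm z ^ (2 * n + 2) * e)).
        - apply Rmult_lt_compat_l; [assumption|]. now apply Rmult_lt_compat_l.
        - right. unfold e. field. lra. }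
      lra.
    - assert (E1 := Eg z Hz). rewrite Z in E1.
      assert (Tz : theta z = C0).
      { apply (Cpow_eq0 _ (2 * n + 2)). transitivity (theta z ^ (2 * n + 2) * C1)%cx; [ring|].
        rewrite E1. ring. }
      apply Hnz. rewrite <- (Etp z Hz), Tz. rewrite <- H0 at 1. apply Etp, Disk_C0. }
  intros z Hz. apply (cdiff_disk_ext (fun z => g1 z / g z)%cx theta z Hz).
  - intros w Hw. assert (E : g1 w = (g w * theta w)%cx).
    { symmetry. destruct (classic (w = C0)) as [->|]; [assumption|now apply Eq]. }
    rewrite E. field. now apply Hgn.
  - apply (cdiff_div g1 g); [now apply Hg1|now apply Hg|now apply Hgn].
Qed.

Lemma cusp_equiv_rotation n alpha beta theta psi : (1 <= n)%nat ->
  cusp_equiv n alpha beta theta psi ->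
  exists tau, Cnorm tau = 1 /\ forall z, Disk z -> theta z = (tau * z)%cx.
Proof.
  intros Hn H. pose proof (algebra_equiv_sym _ _ _ _ H) as H'.
  pose proof H as [Dt [Dp [Etp [Ept _]]]].
  pose proof (cusp_equiv_holo _ _ _ _ _ Hn H) as Ht.
  apply modulus_preserving_rotation; [assumption|]. intros z Hz. apply Rle_antisym.
  - apply schwarz_lemma; try assumption. now apply (cusp_equiv_fixes_0 n alpha beta theta psi).
  - rewrite <- (Etp z Hz) at 1. apply schwarz_lemma; auto.
    + now apply (cusp_equiv_holo n beta alpha psi theta).
    + now apply (cusp_equiv_fixes_0 n beta alpha psi theta).
Qed.

(** * Comparison of coefficients *)

Lemma Cpow_C1 k : (C1 ^ k)%cx = C1.
Proof. induction k; simpl; [reflexivity|]. rewrite IHk. ring. Qed.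

Lemma rotated_coeffs tau sigma a b j : (1 <= j)%nat -> (tau * sigma)%cx = C1 ->
  (b * tau ^ (2 * j + 1) - tau ^ 2 * a)%cx = C0 -> b = (sigma ^ (2 * j - 1) * a)%cx.
Proof.
  intros Hj Hts H. replace (2 * j + 1)%nat with (2 * j - 1 + 2)%nat in H by lia.
  rewrite Cpow_add in H. set (k := (2 * j - 1)%nat) in *.
  assert (Hk : (tau ^ k * sigma ^ k)%cx = C1) by (rewrite <- Cpow_mull, Hts; apply Cpow_C1).
  apply Csub_eq0.
  (* The hypothesis is divided by [tau ^ (k + 2)], written as multiplication by [sigma ^ (k + 2)];
     the two correction terms vanish because [tau * sigma] is 1. *)
  transitivity ((b * (tau ^ k * tau ^ 2) - tau ^ 2 * a) * (sigma ^ k * sigma ^ 2)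
    - b * ((tau ^ k * sigma ^ k) * (tau * sigma) ^ 2 - C1)
    + sigma ^ k * a * ((tau * sigma) ^ 2 - C1))%cx; [ring|].
  rewrite H, Hk, Hts. ring.
Qed.

Lemma cusp_equiv_coeffs n alpha beta theta psi : (1 <= n)%nat ->
  cusp_equiv n alpha beta theta psi ->
  exists tau, Cnorm tau = 1 /\
    forall j, (1 <= j <= n)%nat -> beta j = (tau ^ (2 * j - 1) * alpha j)%cx.
Proof.
  intros Hn H. destruct (cusp_equiv_rotation _ _ _ _ _ Hn H) as [tau [Nt Et]].
  (* [theta] pulls functions back, so the coefficients transform by the inverse rotation:
     [beta j * tau ^ (2 * j + 1)] equals [tau ^ 2 * alpha j]. *)
  exists (Conj tau). split; [now rewrite Cnorm_conj|].
  pose proof H as [_ [_ [_ [_ [Pt _]]]]].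
  destruct (Pt _ (cusp_pi n beta Hn)) as [c [g [Hg E]]].
  (* [gamma k] is the coefficient of [z ^ (2 * k + 1)] in [pi_alpha n beta (tau * z) - tau ^ 2 *
     pi_alpha n alpha z]. Index 0 stands for the linear term, absent from both primitives, and [c']
     absorbs the subtracted multiple into the polynomial part. *)
  set (gamma := fun k => match k with O => C0 | _ => (beta k * tau ^ (2 * k + 1) - tau ^ 2 * alpha k)%cx end).
  set (c' := fun k => (c k - tau ^ 2 * (if Nat.eq_dec k 1 then C1 else C0))%cx).
  assert (Z := cusp_coeffs_zero n alpha c' gamma).
  assert (Ez : forall z, Disk z ->
    (Csum (S n) (fun k => c' k * pi_alpha n alpha z ^ k) - Csum (S n) (fun k => gamma k * z ^ (2 * k + 1)))%cx
    = ((- C1) * (z ^ (2 * n + 2) * g z))%cx).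
  { intros z Hz. specialize (E z Hz). rewrite Et in E by assumption.
    assert (E1 : Csum (S n) (fun k => c' k * pi_alpha n alpha z ^ k)%cx =
      (Csum (S n) (fun k => c k * pi_alpha n alpha z ^ k) - tau ^ 2 * pi_alpha n alpha z)%cx).
    { rewrite (Csum_ext _ _ (fun k => c k * pi_alpha n alpha z ^ k + (- tau ^ 2) *
          ((if Nat.eq_dec k 1 then C1 else C0) * pi_alpha n alpha z ^ k))%cx)
        by (intros; unfold c'; ring).
      rewrite Csum_add, Csum_scal.
      rewrite (Csum_split (S n) 2 (fun k => (if Nat.eq_dec k 1 then C1 else C0) * pi_alpha n alpha z ^ k)%cx) by lia.
      rewrite (Csum_zero (S n - 2)) by (intros k _; destruct Nat.eq_dec; [lia|ring]).
      simpl Csum at 2. simpl Nat.eq_dec. cbv iota.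
      replace (pi_alpha n alpha z ^ 1)%cx with (pi_alpha n alpha z) by (simpl; ring). ring. }
    assert (E2 : Csum (S n) (fun k => gamma k * z ^ (2 * k + 1))%cx =
      (pi_alpha n beta (tau * z) - tau ^ 2 * pi_alpha n alpha z)%cx).
    { rewrite (Csum_split (S n) 1) by lia. replace (S n - 1)%nat with n by lia.
      change (Csum 1 (fun k => gamma k * z ^ (2 * k + 1))%cx) with (C0 + C0 * z ^ (2 * 0 + 1))%cx.
      unfold pi_alpha.
      rewrite (Csum_ext n (fun k => gamma (1 + k)%nat * z ^ (2 * (1 + k) + 1))%cx
        (fun k => beta (S k) * (tau * z) ^ (2 * S k + 1)
                  + (- tau ^ 2) * (alpha (S k) * z ^ (2 * S k + 1)))%cx).
      - rewrite Csum_add, Csum_scal. ring.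
      - intros k _. unfold gamma. rewrite Cpow_mull. simpl Nat.add at 1. cbv iota.
        change (1 + k)%nat with (S k). ring. }
    rewrite E1, E2, E. ring. }
  intros j Hj. apply (rotated_coeffs tau); [lia|now apply Cmul_conj_unit|].
  assert (Zj : gamma j = C0).
  { apply Z; [|lia].
    apply (bigO_ext_loc (fun z => (- C1) * (z ^ (2 * n + 2) * g z))%cx _ _ 1); [lra| |].
    - intros z Hz. symmetry. now apply Ez.
    - apply bigO_scal. apply bigO_weaken with (2 * n + 2 + 0)%nat; [lia|].
      apply (bigO_mul (fun z => z ^ (2 * n + 2))%cx); [apply bigO_pow_id|].
      apply bigO_cont, cdiff_cont, Hg, Disk_C0. }
  destruct j as [|j]; [lia|exact Zj].
Qed.

(** * Rotations are equivalences of cusp algebras *)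

Lemma pi_alpha_rotate n alpha beta tau sigma z : (tau * sigma)%cx = C1 ->
  (forall j, (1 <= j <= n)%nat -> beta j = (tau ^ (2 * j - 1) * alpha j)%cx) ->
  pi_alpha n beta (sigma * z)%cx = (sigma ^ 2 * pi_alpha n alpha z)%cx.
Proof.
  intros Hts Hb. unfold pi_alpha.
  rewrite (Csum_ext n (fun k => beta (S k) * (sigma * z) ^ (2 * S k + 1))%cx
     (fun k => sigma ^ 2 * (alpha (S k) * z ^ (2 * S k + 1)))%cx).
  - rewrite Csum_scal. ring.
  - intros k Hk. rewrite Hb by lia. set (p := (2 * S k - 1)%nat).
    replace (2 * S k + 1)%nat with (p + 2)%nat by (unfold p; lia).
    rewrite !Cpow_add, Cpow_mull.
    assert (Hp : (tau ^ p * sigma ^ p)%cx = C1) by (rewrite <- Cpow_mull, Hts; apply Cpow_C1).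
    transitivity ((tau ^ p * sigma ^ p) * (sigma ^ 2 * (alpha (S k) * (z ^ p * z ^ 2))))%cx; [ring|].
    rewrite Hp. ring.
Qed.

Lemma Disk_rotate sigma z : Cnorm sigma = 1 -> Disk z -> Disk (sigma * z)%cx.
Proof. unfold Disk. intros Hs Hz. rewrite Cnorm_mul, Hs. lra. Qed.

Lemma cusp_rotate n alpha beta tau sigma f : Cnorm sigma = 1 -> (tau * sigma)%cx = C1 ->
  (forall j, (1 <= j <= n)%nat -> beta j = (tau ^ (2 * j - 1) * alpha j)%cx) ->
  A_cusp n beta f -> A_cusp n alpha (fun z => f (sigma * z)%cx).
Proof.
  intros Ns Hts Hb [c [g [Hg E]]].
  (* The rotation multiplies the primitive by [sigma ^ 2], so the polynomial [p (X)] is replaced by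
     [p (sigma ^ 2 X)], of the same degree bound. *)
  exists (fun k => c k * (sigma ^ 2) ^ k)%cx, (fun z => sigma ^ (2 * n + 2) * g (sigma * z))%cx.
  split.
  - intros z Hz. apply (cdiff_mul (fun _ => sigma ^ (2 * n + 2))%cx); [apply cdiff_const|].
    apply (cdiff_comp (fun z => sigma * z)%cx g); [|now apply Hg, Disk_rotate].
    apply (cdiff_mul (fun _ => sigma)); [apply cdiff_const|apply cdiff_id].
  - intros z Hz. rewrite E by now apply Disk_rotate.
    rewrite (pi_alpha_rotate n alpha beta tau sigma z Hts Hb), Cpow_mull. f_equal; [|ring].
    apply Csum_ext. intros k _. rewrite Cpow_mull. ring.
Qed.

Lemma cusp_equiv_of_coeffs n alpha beta tau : Cnorm tau = 1 ->
  (forall j, (1 <= j <= n)%nat -> beta j = (tau ^ (2 * j - 1) * alpha j)%cx) ->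
  cusp_equiv n alpha beta (fun z => Conj tau * z)%cx (fun w => tau * w)%cx.
Proof.
  intros Nt Hb. pose proof (Cmul_conj_unit tau Nt) as Hts.
  assert (Nc : Cnorm (Conj tau) = 1) by now rewrite Cnorm_conj.
  assert (Ha : forall j, (1 <= j <= n)%nat -> alpha j = (Conj tau ^ (2 * j - 1) * beta j)%cx).
  { intros j Hj. rewrite (Hb j Hj).
    transitivity (((tau * Conj tau) ^ (2 * j - 1)) * alpha j)%cx.
    - rewrite Hts, Cpow_C1. ring.
    - rewrite Cpow_mull. ring. }
  assert (Hst : (Conj tau * tau)%cx = C1) by (rewrite <- Hts; ring).
  repeat split.
  - intros z. now apply Disk_rotate.
  - intros w. now apply Disk_rotate.
  - intros z _. transitivity ((tau * Conj tau) * z)%cx; [ring|]. rewrite Hts. ring.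
  - intros z _. transitivity ((tau * Conj tau) * z)%cx; [ring|]. rewrite Hts. ring.
  - intros f. now apply (cusp_rotate n alpha beta tau).
  - intros f. now apply (cusp_rotate n beta alpha (Conj tau)).
Qed.

Theorem theorem4p5 (n : nat) (alpha beta : nat -> Cx)
  (Na Nb : nat) (Oa Ob : pt -> Prop) (ha hb : Cx -> pt) :
  (1 <= n)%nat ->
  holomap Na Oa ha -> holizes Na ha (A_cusp n alpha) ->
  holomap Nb Ob hb -> holizes Nb hb (A_cusp n beta) ->
  ((exists phi, biholo_homeo Na Nb (image_disk ha) (image_disk hb) phi) <->
   (exists tau : Cx, Cnorm tau = 1 /\
      forall j, (1 <= j <= n)%nat -> beta j = Cmul (Cpow tau (2 * j - 1)) (alpha j))).
Proof.
  intros Hn [Oina [_ [_ [Ha _]]]] HA [Oinb [_ [_ [Hb _]]]] HB.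
  assert (Hina : forall z, Disk z -> inCN Na (ha z)) by auto.
  assert (Hinb : forall z, Disk z -> inCN Nb (hb z)) by auto.
  pose proof (cusp_separates n alpha) as SA. pose proof (cusp_separates n beta) as SB.
  split.
  - intros [phi Hphi].
    destruct (algebra_equiv_of_biholo _ _ Na Nb ha hb Hina Hinb HA HB SA SB phi Hphi)
      as [theta [psi H]].
    exact (cusp_equiv_coeffs n alpha beta theta psi Hn H).
  - intros [tau [Nt Ht]].
    apply (biholo_of_algebra_equiv _ _ Na Nb ha hb _ _ Hina Hinb HA HB SA SB
             (cusp_equiv_of_coeffs n alpha beta tau Nt Ht)).
Qed.
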